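(* Let $n\ge3$ and $G=\mathrm{Hol}(C_{2^n})$. For $m\ge1$ let $\zeta_m$ denote a primitive $m$-th root of unity. The Wedderburn decomposition of the rational group algebra $\mathbb{Q}[G]$ is $$\mathbb{Q}[G]\cong\bigoplus_{d\mid 2^{n-2}}\mathbb{Q}(\zeta_d)^{(2)}\ \oplus\ \bigoplus_{d\mid 2^{n-2}}\mathbb{Q}(\zeta_d)^{(2)}\ \oplus\ \bigoplus_{k=2}^{n}\bigoplus_{l=0}^{n-k}M_{2^{k-1}}\big(\mathbb{Q}(\zeta_{2^l})\big).$$
   Context: $C_m$ is the cyclic group of order $m$; $\mathrm{Hol}(C_m)=C_m\rtimes\mathrm{Aut}(C_m)$ for the natural action; $K^{(2)}$ denotes the direct sum $K\oplus K$ of two copies of $K$; $M_m(K)$ is the algebra of $m\times m$ matrices over $K$. The isomorphism is one of $\mathbb{Q}$-algebras. *)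

(* Defs.v *)
From HB Require Import structures.
From mathcomp Require Import all_boot all_order all_algebra all_fingroup.
From mathcomp Require Import all_solvable all_field.

Set Implicit Arguments.
Unset Strict Implicit.
Unset Printing Implicit Defensive.

Import GRing.Theory.

Local Open Scope ring_scope.

Section GroupAlgebra.
Variables (R : comNzRingType) (gT : finGroupType).

(* u represents \sum_x u x . x, so the product is the convolution below; an
   alias, because {ffun gT -> R} already carries the pointwise product. *)
Definition group_alg := {ffun gT -> R}.

HB.instance Definition _ := GRing.Lmodule.copy group_alg {ffun gT -> R^o}.

Implicit Types u v w : group_alg.

Definition group_alg_one : group_alg := [ffun x => (x == 1%g)%:R].
Definition group_alg_mul u v : group_alg :=
  [ffun x => \sum_y u y * v (y^-1 * x)%g].

Fact group_alg_mulA : associative group_alg_mul.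
Proof.
move=> u v w; apply/ffunP=> x; rewrite !ffunE.
under eq_bigr do rewrite ffunE big_distrr /=.
under [RHS]eq_bigr do rewrite ffunE big_distrl /=.
rewrite [RHS]exchange_big /=; apply: eq_bigr => y _.
rewrite [RHS](reindex_inj (mulgI y)) /=; apply: eq_bigr => z _.
by rewrite mulKg invMg mulrA !mulgA.
Qed.

Fact group_alg_mul1l : left_id group_alg_one group_alg_mul.
Proof.
move=> u; apply/ffunP=> x; rewrite !ffunE (bigD1 1%g) //= big1 ?addr0 => [|y].
  by rewrite ffunE eqxx mul1r invg1 mul1g.
by rewrite ffunE => /negPf->; rewrite mul0r.
Qed.

Fact group_alg_mul1r : right_id group_alg_one group_alg_mul.
Proof.
move=> u; apply/ffunP=> x; rewrite !ffunE (bigD1 x) //= big1 ?addr0 => [|y ne].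
  by rewrite ffunE mulVg eqxx mulr1.
by rewrite ffunE -eq_mulVg1 (negPf ne) mulr0.
Qed.

Fact group_alg_mulDl : left_distributive group_alg_mul +%R.
Proof.
move=> u v w; apply/ffunP=> x; rewrite !ffunE -big_split /=.
by apply: eq_bigr => y _; rewrite ffunE mulrDl.
Qed.

Fact group_alg_mulDr : right_distributive group_alg_mul +%R.
Proof.
move=> u v w; apply/ffunP=> x; rewrite !ffunE -big_split /=.
by apply: eq_bigr => y _; rewrite ffunE mulrDr.
Qed.

Fact group_alg_one_neq0 : group_alg_one != 0.
Proof. by apply/eqP=> /ffunP/(_ 1%g)/eqP; rewrite !ffunE eqxx oner_eq0. Qed.

HB.instance Definition _ := GRing.Zmodule_isNzRing.Build group_alg
  group_alg_mulA group_alg_mul1l group_alg_mul1r group_alg_mulDl group_alg_mulDr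
  group_alg_one_neq0.

Fact group_alg_scalerAl (a : R) u v : a *: (u * v) = (a *: u) * v.
Proof.
apply/ffunP=> x; rewrite !ffunE scaler_sumr.
by apply: eq_bigr => y _; rewrite ffunE /= -mulrA.
Qed.

Fact group_alg_scalerAr (a : R) u v : a *: (u * v) = u * (a *: v).
Proof.
apply/ffunP=> x; rewrite !ffunE scaler_sumr.
by apply: eq_bigr => y _; rewrite ffunE mulrCA.
Qed.

HB.instance Definition _ :=
  GRing.Lmodule_isLalgebra.Build R group_alg group_alg_scalerAl.
HB.instance Definition _ :=
  GRing.Lalgebra_isAlgebra.Build R group_alg group_alg_scalerAr.

End GroupAlgebra.

(* The external direct sum of the A i for i in s, with componentwise operations:
   one summand for each member of s, whatever its multiplicity in s. *)
Definition dsum (T : choiceType) (s : seq T) (A : T -> Type) :=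
  {dffun forall i : seq_sub s, A (ssval i)}.

Notation "\dsum_ ( i <- s ) A" := (dsum s (fun i => A%type))
  (at level 41, A at level 41, i, s at level 50,
   format "'[' \dsum_ ( i  <-  s ) '/  '  A ']'") : type_scope.

Section DirectSumZmodule.
Variables (T : choiceType) (s : seq T) (A : T -> zmodType).
Local Notation sumA := (dsum s (fun i => A i)).
Implicit Types u v w : sumA.

HB.instance Definition _ := Choice.copy sumA
  {dffun forall i : seq_sub s, A (ssval i)}.

Definition dsum_zero : sumA := [ffun i : seq_sub s => 0 : A (ssval i)].
Definition dsum_opp u : sumA := [ffun i : seq_sub s => - u i].
Definition dsum_add u v : sumA := [ffun i : seq_sub s => u i + v i].

Fact dsum_addA : associative dsum_add.
Proof. by move=> u v w; apply/ffunP=> i; rewrite !ffunE addrA. Qed.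
Fact dsum_addC : commutative dsum_add.
Proof. by move=> u v; apply/ffunP=> i; rewrite !ffunE addrC. Qed.
Fact dsum_add0 : left_id dsum_zero dsum_add.
Proof. by move=> u; apply/ffunP=> i; rewrite !ffunE add0r. Qed.
Fact dsum_addN : left_inverse dsum_zero dsum_opp dsum_add.
Proof. by move=> u; apply/ffunP=> i; rewrite !ffunE addNr. Qed.

HB.instance Definition _ :=
  GRing.isZmodule.Build sumA dsum_addA dsum_addC dsum_add0 dsum_addN.

End DirectSumZmodule.

Section DirectSumRing.
Variables (T : choiceType) (s : seq T) (A : T -> pzRingType).
Local Notation sumA := (dsum s (fun i => A i)).
Implicit Types u v w : sumA.

Definition dsum_one : sumA := [ffun i : seq_sub s => 1 : A (ssval i)].
Definition dsum_mul u v : sumA := [ffun i : seq_sub s => u i * v i].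

Fact dsum_mulA : associative dsum_mul.
Proof. by move=> u v w; apply/ffunP=> i; rewrite !ffunE mulrA. Qed.
Fact dsum_mul1l : left_id dsum_one dsum_mul.
Proof. by move=> u; apply/ffunP=> i; rewrite !ffunE mul1r. Qed.
Fact dsum_mul1r : right_id dsum_one dsum_mul.
Proof. by move=> u; apply/ffunP=> i; rewrite !ffunE mulr1. Qed.
Fact dsum_mulDl : left_distributive dsum_mul +%R.
Proof. by move=> u v w; apply/ffunP=> i; rewrite !ffunE mulrDl. Qed.
Fact dsum_mulDr : right_distributive dsum_mul +%R.
Proof. by move=> u v w; apply/ffunP=> i; rewrite !ffunE mulrDr. Qed.

HB.instance Definition _ := GRing.Zmodule_isPzRing.Build sumA
  dsum_mulA dsum_mul1l dsum_mul1r dsum_mulDl dsum_mulDr.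

End DirectSumRing.

Section DirectSumLmodule.
Variables (R : pzRingType) (T : choiceType) (s : seq T) (A : T -> lmodType R).
Local Notation sumA := (dsum s (fun i => A i)).
Implicit Types u v : sumA.

Definition dsum_scale (a : R) u : sumA := [ffun i : seq_sub s => a *: u i].

Fact dsum_scaleA a b u : dsum_scale a (dsum_scale b u) = dsum_scale (a * b) u.
Proof. by apply/ffunP=> i; rewrite !ffunE scalerA. Qed.
Fact dsum_scale1 : left_id 1 dsum_scale.
Proof. by move=> u; apply/ffunP=> i; rewrite !ffunE scale1r. Qed.
Fact dsum_scaleDr : right_distributive dsum_scale +%R.
Proof. by move=> a u v; apply/ffunP=> i; rewrite !ffunE scalerDr. Qed.
Fact dsum_scaleDl u : {morph dsum_scale^~ u : a b / a + b}.
Proof. by move=> a b; apply/ffunP=> i; rewrite !ffunE scalerDl. Qed.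

HB.instance Definition _ := GRing.Zmodule_isLmodule.Build R sumA
  dsum_scaleA dsum_scale1 dsum_scaleDr dsum_scaleDl.

End DirectSumLmodule.

Section MatrixAlgebra.
Variables (R : pzRingType) (K : lalgType R) (m : nat).

(* M_m(K) with scalars in R, acting entrywise; 'M[K]_m itself only carries the
   scaling by elements of K. *)
Definition mx_alg := 'M[K]_m.

HB.instance Definition _ := GRing.PzRing.copy mx_alg 'M[K]_m.

Implicit Types u v : mx_alg.

Definition mx_alg_scale (a : R) u : mx_alg := map_mx ( *:%R a) u.

Fact mx_alg_scaleA a b u :
  mx_alg_scale a (mx_alg_scale b u) = mx_alg_scale (a * b) u.
Proof. by apply/matrixP=> i j; rewrite !mxE scalerA. Qed.
Fact mx_alg_scale1 : left_id 1 mx_alg_scale.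
Proof. by move=> u; apply/matrixP=> i j; rewrite !mxE scale1r. Qed.
Fact mx_alg_scaleDr : right_distributive mx_alg_scale +%R.
Proof. by move=> a u v; apply/matrixP=> i j; rewrite !mxE scalerDr. Qed.
Fact mx_alg_scaleDl u : {morph mx_alg_scale^~ u : a b / a + b}.
Proof. by move=> a b; apply/matrixP=> i j; rewrite !mxE scalerDl. Qed.

HB.instance Definition _ := GRing.Zmodule_isLmodule.Build R mx_alg
  mx_alg_scaleA mx_alg_scale1 mx_alg_scaleDr mx_alg_scaleDl.

End MatrixAlgebra.

Definition adjoin (F : fieldType) (L : fieldExtType F) (z : L) :
  fieldExtType F := subvs_of <<1; z>>%AS.

(* Automorphisms of A are permutations of gT supported on A, composed from left
   to right and acting on the right. *)
Definition Hol (gT : finGroupType) (A : {group gT}) : finGroupType :=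
  sdprod_by [Aut A]%gact.

(* Main.v *)
(* Let c generate C, let t be the inversion and s the fifth power map on C; every
   element of Hol(C) is t^e s^j c^i in exactly one way.  For 2 <= k <= n and z a
   primitive 2^l-th root of unity with l <= n - k, there are matrices X, S, T of
   size 2^(k-1) over Q(z) satisfying the relations of c, s, t with
   X^(2^(k-1)) = -1 and S^(2^(k-2)) = z: that they exist over Q(z) itself is the
   triviality of the Schur index.  Any h outside the subgroup generated by
   s^(2^(k-2)) and c^(2^(k-1)) acts with trace 0, so an element u of Q[Hol(C)]
   killed by this representation for every l satisfies
   sum_i (-1)^i u(c^(2^(k-1) i) g) = 0 for all g, by the irreducibility of the
   cyclotomic polynomials.  The characters of degree 1 give the same for k = 1,
   together with sum_i u(c^i g) = 0, and all these relations force u = 0.  The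
   product of the representations is therefore injective, and it is bijective
   because the dimensions agree. *)

From HB Require Import structures.
Require Import Defs.
From mathcomp Require Import all_boot all_order all_algebra all_fingroup.
From mathcomp Require Import all_solvable all_field.
From mathcomp Require Import zify ring.

Set Implicit Arguments.
Unset Strict Implicit.
Unset Printing Implicit Defensive.

Import GRing.Theory.

Local Open Scope ring_scope.

(** * Powers of 5 modulo powers of 2 *)

(** Squaring [1 + 2 ^ (a + 2) * w] with [w] odd gives [1 + 2 ^ (a + 3) * (w + 2 ^ (a + 1) * w ^ 2)],
    whose last factor is again odd. So [5 ^ 2 ^ a - 1] has 2-adic valuation exactly [a + 2]. *)
Lemma exp5_2X a : exists b, (5 ^ 2 ^ a = 1 + 2 ^ (a + 2) * b.*2.+1)%N.
Proof.
elim: a => [|a [b IH]]; first by exists 0%N.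
exists (b + 2 ^ a * b.*2.+1 * b.*2.+1)%N.
rewrite expnSr expnM IH addSn (expnS 2 (a + 2)) expnD -!muln2 -mulnn.
by ring.
Qed.

Lemma pow2_part k i : ~~ (2 ^ k %| i)%N ->
  exists2 a, (a < k)%N & exists b, i = (2 ^ a * b.*2.+1)%N.
Proof.
move=> ndv; have i_gt0: (0 < i)%N by case: i ndv => //; rewrite dvdn0.
have [b cob iE] := pfactor_coprime (isT : prime 2) i_gt0.
exists (logn 2 i); first by rewrite ltnNge -pfactor_dvdn.
exists b./2; rewrite [LHS]iE mulnC; congr (_ * _)%N.
by rewrite -[LHS]odd_double_half -coprime2n cob add1n.
Qed.

(** Raising to an odd power keeps the valuation of [5 ^ 2 ^ a - 1], so the valuation of [5 ^ j - 1]
    is that of [j] plus 2. *)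
Lemma exp5_part j : (0 < j)%N ->
  exists a b d, (j = 2 ^ a * d.*2.+1)%N /\ (5 ^ j = 1 + 2 ^ (a + 2) * b.*2.+1)%N.
Proof.
move=> j_gt0; have [|a _ [d ->]] := @pow2_part j j.
  by apply/negP=> /(dvdn_leq j_gt0); rewrite leqNgt ltn_expl.
exists a; have [b Hb] := exp5_2X a; rewrite expnM Hb.
suff [b' Hb']: exists b',
    ((1 + 2 ^ (a + 2) * b.*2.+1) ^ d.*2.+1 = 1 + 2 ^ (a + 2) * b'.*2.+1)%N.
  by exists b', d.
elim: d => [|d [b' IH]]; first by exists b; rewrite expn1.
rewrite doubleS 2!expnS IH expnD -!muln2.
exists (b' + (b*2+1) * (1 + 2 ^ a * 4 * (b'*2+1)) * (1 + 2 ^ a * 2 * (b*2+1)))%N.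
by rewrite -(muln2 (_ + _)); ring.
Qed.

(* Here and below 2^n - 1 plays the role of -1, to keep all exponents in nat. *)
Lemma unit_neq1_mod n k e j : (2 <= k <= n)%N -> (e < 2)%N ->
  ~~ ((e == 0%N) && (2 ^ (k - 2) %| j)%N) ->
  ~~ (2 ^ k %| (2 ^ n - 1) ^ e * 5 ^ j - 1)%N.
Proof.
move=> /andP[k2 kn] e2 H; apply/negP.
have E4: (2 ^ k = 4 * 2 ^ (k - 2))%N by rewrite -(expnD 2 2) subnKC.
have n4: (2 ^ n = 4 * 2 ^ (n - 2))%N by rewrite -(expnD 2 2) subnKC // (leq_trans k2).
have [j0|j_gt0] := posnP j.
  move: H; rewrite j0 dvdn0 andbT; case: e e2 => [|[|]] // _ _.
  rewrite expn1 expn0 muln1 n4 E4 => /dvdnP[x].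
  have := expn_gt0 2 (n - 2); lia.
have [a [b [d [jE pE]]]] := exp5_part j_gt0.
(* For [e = 0], comparing valuations gives [k <= a + 2], so [2 ^ (k - 2)] divides [j]. For [e = 1]
   the unit is -1 modulo 4, and subtracting 1 leaves 2 modulo 4. *)
case: e e2 H => [|[|]] // _ H /dvdnP[x].
  rewrite expn0 mul1n pE addKn => Hx.
  case/negP: H; rewrite eqxx jE /= dvdn_mulr // dvdn_exp2l //.
  rewrite leq_subLR addnC -(@dvdn_Pexp2l 2) // -(@Gauss_dvdl _ _ (b.*2.+1)).
    by rewrite Hx dvdn_mull.
  by rewrite coprime_pexpl ?(leq_trans _ k2) // coprime2n /= odd_double.
rewrite expn1 pE n4 E4 expnD.
have := expn_gt0 2 (n - 2); set v := (2 ^ (n - 2))%N; set w := (b.*2.+1)%N.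
set y := (2 ^ a)%N; set z := (2 ^ (k-2))%N => v0 Hx.
move: Hx; rewrite mulnDr muln1.
have -> : ((4 * v - 1) * (y * 2 ^ 2 * w) = 4 * ((4 * v - 1) * (y * w)))%N by ring.
rewrite (mulnCA x); set t := ((4 * v - 1) * _)%N; set r := (x * z)%N; lia.
Qed.

Lemma dvdn_half_multiple k w : ~~ (2 ^ k %| w)%N ->
  exists v b, (w * v = 2 ^ (k - 1) * b.*2.+1)%N.
Proof.
case/pow2_part=> a ak [b ->]; exists (2 ^ (k - 1 - a))%N, b.
by rewrite mulnAC -expnD subnKC // subn1 -ltnS prednK ?(leq_trans _ ak).
Qed.

(** If [i] has valuation [a], a unit [w] with [w - 1] of valuation [k - 1 - a] is wanted:
    [2 ^ n - 1] when this is 1, and [5 ^ 2 ^ (k - 3 - a)] when it is larger. *)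
Lemma unit_move_half n k i : (2 <= k <= n)%N -> ~~ (2 ^ (k - 1) %| i)%N ->
  exists e j b, (i * ((2 ^ n - 1) ^ e * 5 ^ j - 1) = 2 ^ (k - 1) * b.*2.+1)%N.
Proof.
move=> /andP[k2 kn] /pow2_part[a ak [b ->]].
have [ak2|ak2] := eqVneq a.+2 k.
  exists 1%N, 0%N; rewrite expn1 expn0 muln1.
  exists (b * (2 ^ (n - 1) - 1) + (2 ^ (n - 2) - 1))%N.
  have -> : (k - 1 = a.+1)%N by lia.
  have -> : (n = n.-2.+2)%N by lia.
  have -> : (n.-2.+2 - 1 = n.-2.+1)%N by lia.
  have -> : (n.-2.+2 - 2 = n.-2)%N by lia.
  have := expn_gt0 2 n.-2; rewrite !expnS; set y := (2 ^ n.-2)%N => y0.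
  have -> : (2 * (2 * y) - 1 - 1 = 2 * (2 * (y - 1)).+1)%N by lia.
  have -> : (2 * y - 1 = (2 * (y - 1)).+1)%N by lia.
  by rewrite -!muln2; ring.
have [d Hd] := exp5_2X (k - 3 - a).
exists 0%N, (2 ^ (k - 3 - a))%N, (b + (d + 2 * b * d))%N.
rewrite expn0 mul1n Hd addKn mulnACA -expnD; congr (2 ^ _ * _)%N; first by lia.
by rewrite -!muln2; ring.
Qed.

(** The geometric sum is the quotient of [5 ^ 2 ^ (r - 2 + a) - 1] by [5 ^ 2 ^ (r - 2) - 1], whose
    valuations are [r + a] and [r]. *)
Lemma sum_exp_pow2 a r : (2 <= r)%N -> exists b,
  (\sum_(0 <= t < 2 ^ a) (5 ^ 2 ^ (r - 2)) ^ t = 2 ^ a * b.*2.+1)%N.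
Proof.
move=> r2; have [b Hb] := exp5_2X (r - 2); have [b' Hb'] := exp5_2X (r - 2 + a).
rewrite big_mkord; have Hw : (b'.*2.+1 * (2 ^ a) * (2 ^ r) =
    2 ^ r * b.*2.+1 * \sum_(t < 2 ^ a) (5 ^ 2 ^ (r - 2)) ^ t)%N.
  have := predn_exp (5 ^ 2 ^ (r - 2)) (2 ^ a).
  rewrite -!subn1 -expnM -expnD Hb' [(5 ^ _ - 1)%N](congr1 (subn^~ 1%N) Hb) !addKn.
  rewrite addnAC subnK // expnD => <-; lia.
have Hd : (b.*2.+1 %| b'.*2.+1)%N.
  rewrite -(@Gauss_dvdl _ _ (2 ^ a * 2 ^ r)); last first.
    by rewrite coprimeMr !coprimeXr // coprime_sym coprime2n /= odd_double.
  by rewrite mulnA Hw mulnAC dvdn_mull.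
have [x Hx] := dvdnP Hd; exists x./2.
have ox : odd x by have := congr1 odd Hx; rewrite oddM /= !odd_double andbT => <-.
have -> : x./2.*2.+1 = x by rewrite -[RHS]odd_double_half ox.
apply/eqP; rewrite -(@eqn_pmul2l (2 ^ r * b.*2.+1)) ?muln_gt0 ?expn_gt0 // -Hw Hx.
by apply/eqP; lia.
Qed.

(** * Monomial matrices acting affinely on indices *)

Lemma expr_twist_comm (B : pzRingType) (X Y : B) g a j :
  X * Y = Y * X ^+ g -> X ^+ a * Y ^+ j = Y ^+ j * X ^+ (a * g ^ j).
Proof.
move=> XY; have XYa b : X ^+ b * Y = Y * X ^+ (b * g).
  elim: b => [|b IH]; first by rewrite mul1r mulr1.
  by rewrite exprS -mulrA IH mulrA XY -mulrA -exprD mulSn.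
elim: j a => [|j IH] a; first by rewrite mulr1 mul1r muln1.
by rewrite exprSr mulrA IH -!mulrA XYa expnSr mulnA.
Qed.

Lemma expr_mod1 (B : pzRingType) (X : B) N i j :
  X ^+ N = 1 -> i = j %[mod N] -> X ^+ i = X ^+ j.
Proof. by move=> X1 ij; rewrite -(expr_mod i X1) ij expr_mod. Qed.

Section AffineMonomial.
Variables (F : fieldType) (N : nat) (N_gt0 : (0 < N)%N) (y : F).

(* The basis e_0, ..., e_{N-1} extended to all indices by e_{i+N} = y e_i *)
Definition mono_vec i : 'rV[F]_N :=
  y ^+ (i %/ N) *: delta_mx 0 (Ordinal (ltn_pmod i N_gt0)).

Definition mono_mx g b : 'M[F]_N := \matrix_(i < N) mono_vec (g * i + b).

Lemma mono_vecD i c : mono_vec (i + N * c) = y ^+ c *: mono_vec i.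
Proof.
rewrite /mono_vec scalerA -exprD mulnC addnC divnMDl //.
by congr (_ *: delta_mx _ _); apply: val_inj; rewrite /= modnMDl.
Qed.

Lemma mono_vec_mod o i j : y ^+ o = 1 -> i = j %[mod N * o] ->
  mono_vec i = mono_vec j.
Proof.
move=> yo ij; rewrite (divn_eq i (N * o)) (divn_eq j (N * o)) ij.
rewrite ![(_ * (N * o))%N]mulnC -!mulnA ![(_ + _ %% _)%N]addnC !mono_vecD.
by rewrite ![y ^+ (o * _)]exprM yo !expr1n.
Qed.

(** The rows prescribe the affine rule for indices below [N] only; [y ^+ g = y] makes it compatible
    with e_{i+N} = y e_i, hence valid for all indices. *)
Lemma mono_vec_mx i g b : y ^+ g = y ->
  mono_vec i *m mono_mx g b = mono_vec (g * i + b).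
Proof.
move=> yg; rewrite -scalemxAl -rowE rowK.
have -> : (g * i + b = g * (i %% N) + b + N * (g * (i %/ N)))%N.
  by rewrite {1}(divn_eq i N); ring.
by rewrite mono_vecD exprM yg.
Qed.

Lemma mono_eqP (A B : 'M[F]_N) :
  (forall i, mono_vec i *m A = mono_vec i *m B) -> A = B.
Proof.
move=> AB; apply/row_matrixP=> i; have := AB i.
have -> : mono_vec i = delta_mx 0 i; last by rewrite !rowE.
rewrite /mono_vec divn_small // scale1r; congr delta_mx.
by apply: val_inj; rewrite /= modn_small.
Qed.

Lemma mono_vec_mxX i g b j : y ^+ g = y ->
  mono_vec i *m (mono_mx g b) ^+ j
  = mono_vec (g ^ j * i + b * \sum_(0 <= t < j) g ^ t)%N.
Proof.
move=> yg; elim: j => [|j IH].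
  by rewrite mulmx1 big_geq // muln0 addn0 mul1n.
rewrite exprSr [_ *m _]mulmxA IH mono_vec_mx //; congr mono_vec.
rewrite big_nat_recl // expnS mulnDr -addnA mulnA; congr (_ + _)%N.
rewrite mulnDr muln1 addnC; congr (_ + _)%N.
by rewrite mulnCA big_distrr /=; congr (_ * _)%N; apply: eq_bigr => t _; rewrite expnS.
Qed.

Lemma mono_mx1_expr b j : mono_mx 1 b ^+ j = mono_mx 1 (j * b).
Proof.
apply: mono_eqP => i; rewrite mono_vec_mxX ?expr1 // mono_vec_mx ?expr1 //.
rewrite exp1n; under eq_bigr do rewrite exp1n.
by rewrite sum_nat_const_nat subn0 muln1 (mulnC j).
Qed.

Lemma mono_mxM g b g' b' : y ^+ g' = y ->
  mono_mx g b * mono_mx g' b' = mono_mx (g' * g) (g' * b + b').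
Proof.
move=> yg'; apply/row_matrixP=> i.
by rewrite row_mul !rowK mono_vec_mx // mulnDr mulnA addnA.
Qed.

Lemma eq_mono_mx o g b g' b' : y ^+ o = 1 ->
  g = g' %[mod N * o] -> b = b' %[mod N * o] -> mono_mx g b = mono_mx g' b'.
Proof.
move=> yo gg bb; apply/row_matrixP=> i; rewrite !rowK; apply: (mono_vec_mod yo).
by rewrite -modnDm bb -modnMml gg modnMml modnDm.
Qed.

Lemma mono_shiftN : mono_mx 1 1 ^+ N = y%:M.
Proof.
rewrite mono_mx1_expr; apply: mono_eqP => i.
by rewrite mono_vec_mx ?expr1 // mul_mx_scalar mul1n mono_vecD.
Qed.

Lemma mono_mx_shift g b : y ^+ g = y ->
  mono_mx 1 1 * mono_mx g b = mono_mx g b * mono_mx 1 1 ^+ g.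
Proof.
move=> yg; rewrite mono_mx1_expr !mono_mxM ?expr1 //.
by congr mono_mx; lia.
Qed.

End AffineMonomial.

(** * Representations of degree 2^(k-1) *)

(* The relations satisfied by the images of a generator c of C, of the fifth power
   map s and of the inversion t; the central element s^(2^(k-2)) acts as z. *)
Definition hol_rep (F : fieldType) (n k : nat) (z : F) N (X S T : 'M[F]_N) :=
  [/\ X ^+ (2 ^ (k - 1)) = -1, S ^+ (2 ^ (k - 2)) = z%:M, T * T = 1,
      T * S = S * T & X * T = T * X ^+ (2 ^ n - 1) /\ X * S = S * X ^+ 5].

(** With [y = -1] indices matter modulo [2 ^ k]; [X], [S], [T] act on them by i + 1, 5i + 2e and -i
    - e. The last two maps commute because both fix the formal point -e/2, and the geometric sum
    makes [S ^+ (2 ^ (k - 2))] a translation by an odd multiple of [N * e], which is the sign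
    [(-1) ^+ e]. *)
Lemma hol_rep_sign (F : fieldType) n k (e : bool) : (2 <= k <= n)%N ->
  exists X S T : 'M[F]_(2 ^ (k - 1)), hol_rep n k ((-1) ^+ e) X S T.
Proof.
move=> /andP[k2 kn]; set N := (2 ^ (k - 1))%N.
have N_gt0 : (0 < N)%N by rewrite expn_gt0.
have n0 : (0 < n)%N by lia.
have N2 : (N * 2 = 2 ^ k)%N by rewrite -expnSr; congr (2 ^ _)%N; lia.
have nE : (2 ^ n = 2 ^ (n - k) * 2 ^ k)%N by rewrite -expnD subnK.
have y2 : (-1 : F) ^+ 2 = 1 by rewrite sqrrN expr1n.
have yodd g : odd g -> (-1 : F) ^+ g = -1 by move=> og; rewrite -signr_odd og.
have y5 := yodd 5%N isT; have yn : (-1 : F) ^+ (2 ^ n - 1) = -1.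
  by apply: yodd; rewrite oddB ?expn_gt0 // oddX; case: (n) n0.
have u0 := expn_gt0 2 (n - k); have v0 := expn_gt0 2 k.
have v4 : (2 ^ 2 <= 2 ^ k)%N by rewrite leq_exp2l.
set u := (2 ^ (n - k))%N in nE u0; set v := (2 ^ k)%N in nE v0 N2 v4.
have mono1 : mono_mx N_gt0 (-1 : F) 1 0 = 1.
  apply: (@mono_eqP _ _ N_gt0 (-1)) => i.
  by rewrite mono_vec_mx ?expr1 // mulmx1 addn0 mul1n.
(* Here [(v - 1) * e] represents -e modulo [v = 2 ^ k]. *)
exists (mono_mx N_gt0 (-1) 1%N 1%N), (mono_mx N_gt0 (-1) 5 (2 * e)%N),
  (mono_mx N_gt0 (-1) (2 ^ n - 1)%N ((v - 1) * e)%N).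
split; last split.
- by rewrite mono_shiftN raddfN.
- apply: (@mono_eqP _ _ N_gt0 (-1)) => i; rewrite mono_vec_mxX //.
  have [b Hb] := sum_exp_pow2 (k - 2) (leqnn 2); rewrite Hb.
  have [b' Hb'] := exp5_2X (k - 2).
  have -> : (2 * e * (2 ^ (k - 2) * b.*2.+1) = N * (b.*2.+1 * e))%N.
    have -> : N = (2 * 2 ^ (k - 2))%N by rewrite -expnS; congr (2 ^ _)%N; lia.
    by ring.
  rewrite mono_vecD exprM mul_mx_scalar.
  congr (_ *: _); last first.
    apply: (mono_vec_mod _ y2); rewrite N2 Hb' subnK // -/v.
    by rewrite (_ : (_ * i = b'.*2.+1 * i * v + i)%N) ?modnMDl //; ring.
  by rewrite yodd //= odd_double.
- rewrite [_ * _]mono_mxM // -mono1; apply: (eq_mono_mx _ y2); rewrite N2.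
    have -> : ((2 ^ n - 1) * (2 ^ n - 1) = (2 ^ n - 2) * u * v + 1)%N by nia.
    by rewrite modnMDl.
  have -> : ((2 ^ n - 1) * ((v - 1) * e) + (v - 1) * e
             = (v - 1) * e * u * v + 0)%N by nia.
  by rewrite modnMDl.
- rewrite [LHS]mono_mxM // [RHS]mono_mxM //; apply: (eq_mono_mx _ y2); rewrite ?N2.
    by rewrite mulnC.
  have -> : (5 * ((v - 1) * e) + 2 * e = (4 * e) * v + (v * e - 3 * e))%N.
    by case: (e) => /=; nia.
  have -> : ((2 ^ n - 1) * (2 * e) + (v - 1) * e = (2 * e * u) * v + (v * e - 3 * e))%N.
    by case: (e) => /=; nia.
  by rewrite !modnMDl.
- exact: mono_mx_shift.
- exact: mono_mx_shift.
Qed.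

(** * Block matrices and induction from subgroups of index 2 *)

Section Blocks.
Variables (R : pzRingType) (q : nat).
Implicit Types A B : 'M[R]_q.

Definition diag2_mx A B : 'M_(q + q) := block_mx A 0 0 B.
Definition anti2_mx A B : 'M_(q + q) := block_mx 0 A B 0.

Lemma diag2_mxM A B A' B' :
  diag2_mx A B * diag2_mx A' B' = diag2_mx (A * A') (B * B').
Proof. by rewrite [LHS]mulmx_block !mul0mx !mulmx0 !addr0 !add0r. Qed.

Lemma diag2_antiM A B A' B' :
  diag2_mx A B * anti2_mx A' B' = anti2_mx (A * A') (B * B').
Proof. by rewrite [LHS]mulmx_block !mul0mx !mulmx0 !addr0 !add0r. Qed.

Lemma anti2_diagM A B A' B' :
  anti2_mx A B * diag2_mx A' B' = anti2_mx (A * B') (B * A').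
Proof. by rewrite [LHS]mulmx_block !mul0mx !mulmx0 !addr0 !add0r. Qed.

Lemma anti2_mxM A B A' B' :
  anti2_mx A B * anti2_mx A' B' = diag2_mx (A * B') (B * A').
Proof. by rewrite [LHS]mulmx_block !mul0mx !mulmx0 !addr0 !add0r. Qed.

Lemma diag2_scalar a : diag2_mx a%:M a%:M = a%:M.
Proof. by rewrite [RHS]scalar_mx_block. Qed.

Lemma diag2_mxX A B j : diag2_mx A B ^+ j = diag2_mx (A ^+ j) (B ^+ j).
Proof.
by elim: j => [|j IH]; rewrite ?diag2_scalar // !exprS IH diag2_mxM.
Qed.

End Blocks.

Lemma scalar_mxX (R : comPzRingType) N (a : R) j : (a%:M : 'M_N) ^+ j = (a ^+ j)%:M.
Proof.
elim: j => [|j IH] //; rewrite !exprS IH [LHS]mul_scalar_mx.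
by rewrite -scale_scalar_mx.
Qed.

(* When z has order 2^l with l >= 2, X^(2^(k-r)) is diagonalizable over Q(z) for
   2 <= r <= min(k, l); this is the action, on one of its eigenspaces, of the
   subgroup generated by c and s^(2^(r-2)), which stabilizes it. *)
Definition hol_block (F : fieldType) (k l r : nat) (z : F) :=
  exists X S : 'M[F]_(2 ^ (k - r)),
    [/\ X ^+ (2 ^ (k - r)) = (z ^+ (2 ^ (l - r)))%:M,
        S ^+ (2 ^ (k - r)) = z%:M
      & X * S = S * X ^+ (5 ^ 2 ^ (r - 2))].

Lemma expr5_fix (F : fieldType) r (y : F) : (2 <= r)%N -> y ^+ (2 ^ r) = 1 ->
  y ^+ (5 ^ 2 ^ (r - 2)) = y.
Proof.
move=> r2 y1; have [b ->] := exp5_2X (r - 2).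
by rewrite subnK // exprD exprM y1 expr1n mulr1 expr1.
Qed.

(** For [k <= l] the matrices are scalars of size 1. For [l < k] they are monomial with [y = z]: [X]
    is the shift and [S] an affine map whose multiplier is 1 modulo [2 ^ l], hence fixes [z] as an
    exponent. *)
Lemma hol_block_top (F : fieldType) k l (z : F) : (2 <= k)%N -> (2 <= l)%N ->
  z ^+ (2 ^ l) = 1 -> hol_block k l (minn k l) z.
Proof.
move=> k2 l2 zl; have [kl|/ltnW lk] := leqP k l.
  rewrite /hol_block subnn; exists (z ^+ (2 ^ (l - k)))%:M, z%:M.
  split; rewrite ?expr1 // scalar_mxX expr5_fix //.
    exact: scalar_mxC.
  by rewrite -exprM -expnD subnK.
have N_gt0 := expn_gt0 2 (k - l) : (0 < _)%N.
have [b Hb] := sum_exp_pow2 (k - l) l2.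
(* The translation part [c] of [S] inverts the odd factor of the geometric sum modulo [2 ^ l], so
   that [S ^+ (2 ^ (k - l))] is exactly [z]. *)
have cop : coprime b.*2.+1 (2 ^ l).
  by rewrite coprimeXr // coprime_sym coprime2n /= odd_double.
have [c d Hc _] := egcdnP (2 ^ l) (isT : 0 < b.*2.+1)%N.
rewrite (eqP cop) in Hc.
rewrite /hol_block subnn.
exists (mono_mx N_gt0 z 1 1), (mono_mx N_gt0 z (5 ^ 2 ^ (l - 2)) c).
have zg := expr5_fix l2 zl.
split; rewrite ?mono_shiftN ?expr1 //; last exact: mono_mx_shift.
apply: (@mono_eqP _ _ N_gt0 z) => i; rewrite mono_vec_mxX // Hb mul_mx_scalar.
rewrite mulnCA mono_vecD Hc exprD mulnC exprM zl expr1n mul1r expr1.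
have [b' Hb'] := exp5_2X (l - 2 + (k - l)).
congr (_ *: _); apply: (mono_vec_mod _ zl).
rewrite -expnM -expnD Hb' addnAC subnK // expnD.
by rewrite (_ : (_ * i = b'.*2.+1 * i * (2 ^ (k - l) * 2 ^ l) + i)%N) ?modnMDl //; ring.
Qed.

(** This is induction from a subgroup of index 2: the new [S] squares to two copies of the old one,
    and conjugation by it exchanges the blocks [X ^+ g] and [X] of the new [X]. Both blocks have the
    same scalar as their power, since that scalar is fixed by the exponent [g]. *)
Lemma hol_block_step (F : fieldType) k l r (z : F) : (2 <= r)%N ->
  (r < k)%N -> (r < l)%N -> z ^+ (2 ^ l) = 1 ->
  hol_block k l r.+1 z -> hol_block k l r z.
Proof.
move=> r2 rk rl zl [X [S [XN SN XS]]]; rewrite /hol_block.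
have -> : (k - r = (k - r.+1).+1)%N by lia.
have lE : (l - r = (l - r.+1).+1)%N by lia.
rewrite expnS mul2n -addnn; set q := (2 ^ _)%N in X S XN SN XS *.
set g := (5 ^ 2 ^ (r - 2))%N.
have gg : (5 ^ 2 ^ (r.+1 - 2) = g * g)%N.
  by rewrite -expnD addnn -mul2n -expnS; congr (_ ^ 2 ^ _)%N; lia.
exists (diag2_mx (X ^+ g) X), (anti2_mx 1 S); split.
- have X2 : X ^+ (q + q) = (z ^+ (2 ^ (l - r)))%:M.
    rewrite exprD XN [LHS]mul_scalar_mx scale_scalar_mx -exprD.
    by rewrite addnn -mul2n -expnS lE.
  rewrite diag2_mxX exprAC X2 scalar_mxX expr5_fix ?diag2_scalar //.
  by rewrite -exprM -expnD subnK // ltnW.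
- have -> : anti2_mx 1 S ^+ (q + q) = (anti2_mx 1 S ^+ 2) ^+ q.
    by rewrite -exprM mul2n -addnn.
  rewrite expr2 anti2_mxM mul1r mulr1 diag2_mxX SN.
  exact: diag2_scalar.
- by rewrite diag2_antiM diag2_mxX anti2_diagM -exprM -gg mul1r mulr1 XS.
Qed.

Lemma prim_root_half (F : fieldType) l (z : F) :
  (2 ^ l.+1).-primitive_root z -> z ^+ (2 ^ l) = -1.
Proof.
move=> zp; have : (z ^+ (2 ^ l)) ^+ 2 = 1.
  by rewrite -exprM -expnSr prim_expr_order.
move/eqP; rewrite sqrf_eq1 -(prim_order_dvd zp) dvdn_Pexp2l // ltnn /=.
by move/eqP.
Qed.

Lemma hol_block_2 (F : fieldType) k l (z : F) : (2 <= k)%N -> (2 <= l)%N ->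
  z ^+ (2 ^ l) = 1 -> hol_block k l 2 z.
Proof.
move=> k2 l2 zl; have := hol_block_top k2 l2 zl.
have : (2 <= minn k l)%N by rewrite leq_min k2.
have : (minn k l <= k)%N by apply: geq_minl.
have : (minn k l <= l)%N by apply: geq_minr.
elim: (minn k l) => [|r IH] // rl rk; rewrite leq_eqVlt => /predU1P[<-//|r2].
by move/(hol_block_step r2 rk rl zl); apply: IH => //; apply: ltnW.
Qed.

(** For [l <= 1], [z] is a sign. Otherwise the block for [r = 2] represents the subgroup generated
    by [c] and [s], and its [X ^+ (2 ^ (k - 2))] is a square root of -1. Inducing along the
    inversion adjoins the block of the inverse of [X], and [T] swaps the two. *)
Lemma hol_rep_exists (F : fieldType) n k l (z : F) : (2 <= k <= n)%N ->
  (2 ^ l).-primitive_root z ->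
  exists X S T : 'M[F]_(2 ^ (k - 1)), hol_rep n k z X S T.
Proof.
move=> kn zp; have zl := prim_expr_order zp.
have [l1|l2] := leqP l 1.
  suff [e ->] : exists e : bool, z = (-1) ^+ e by apply: hol_rep_sign.
  case: l zp zl l1 => [|[|]] // zp zl _.
    by exists false; rewrite -zl.
  by exists true; rewrite -(prim_root_half zp).
have /andP[k2 kn'] := kn.
have [X [S [XN SN XS]]] := hol_block_2 k2 l2 zl.
rewrite /hol_rep (_ : k - 1 = (k - 2).+1)%N; last by lia.
rewrite expnS mul2n -addnn; set q := (2 ^ (k - 2))%N in X S XN SN XS *.
have X2 : X ^+ (q + q) = -1.
  rewrite exprD XN [LHS]mul_scalar_mx scale_scalar_mx -exprD addnn -mul2n -expnS.
  case: l zp l2 {zl SN XN} => [|[|l]] // zp _.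
  by rewrite subSS subSS subn0 (prim_root_half zp) raddfN.
have n0 : (0 < n)%N by lia.
have X1 : X ^+ (2 ^ n) = 1.
  have -> : (2 ^ n = (q + q) * 2 * 2 ^ (n - k))%N.
    transitivity (2 ^ (k - 2 + 2 + (n - k)))%N; first by congr (2 ^ _)%N; lia.
    by rewrite 2!expnD -/q; ring.
  by rewrite 2!exprM X2 sqrrN !expr1n.
exists (diag2_mx X (X ^+ (2 ^ n - 1))), (diag2_mx S S), (anti2_mx 1 1).
split; last split.
- rewrite diag2_mxX exprAC X2 -signr_odd oddB ?expn_gt0 // oddX.
  have -> : (n == 0)%N = false by case: (n) n0.
  by rewrite /= expr1 -(raddfN (@scalar_mx F q)) diag2_scalar raddfN.
- by rewrite diag2_mxX SN diag2_scalar.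
- by rewrite anti2_mxM mul1r diag2_scalar.
- by rewrite anti2_diagM diag2_antiM !mul1r !mulr1.
- rewrite diag2_antiM diag2_mxX anti2_diagM !mulr1 !mul1r; congr anti2_mx.
  rewrite -exprM -[LHS]expr1; apply: (expr_mod1 X1).
  have := expn_gt0 2 n; set v := (2 ^ n)%N => /= v0.
  rewrite (_ : (v - 1) * (v - 1) = (v - 2) * v + 1)%N ?modnMDl //.
  have : (2 ^ 1 <= v)%N by rewrite leq_exp2l.
  nia.
- rewrite diag2_mxX !diag2_mxM XS; congr diag2_mx.
  by have := expr_twist_comm (2 ^ n - 1) 1 XS; rewrite !expr1 exprM.
Qed.

(** * Roots of unity of 2-power order over the rationals *)

Lemma size_XnD1 (R : nzRingType) m : (0 < m)%N -> size ('X^m + 1 : {poly R}) = m.+1.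
Proof. by move=> m0; rewrite size_polyDl size_polyXn // size_poly1 ltnS. Qed.

(** The polynomial is the cyclotomic polynomial of order [2 ^ l.+1]. Its irreducibility is read off
    from a root [w] in [algC], whose minimal polynomial has the same degree, and then applied to the
    gcd with [p], which vanishes at [z]. *)
Lemma dvdp_Xpow2D1 (L : fieldExtType rat) l (z : L) (p : {poly rat}) :
  (2 ^ l.+1).-primitive_root z -> root (map_poly (in_alg L) p) z ->
  'X^(2 ^ l) + 1 %| p.
Proof.
move=> zp pz; set f := 'X^(2 ^ l) + 1.
have sf : size f = (2 ^ l).+1 by rewrite size_XnD1 ?expn_gt0.
have fz : root (map_poly (in_alg L) f) z.
  rewrite rmorphD rmorph1 rmorphXn /= map_polyX rootE hornerD hornerXn hornerC.
  by rewrite (prim_root_half zp) addNr.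
have [w wp] := C_prim_root_exists (expn_gt0 2 l.+1 : (0 < 2 ^ l.+1)%N).
have [m [mE _ mP]] := minCpolyP w.
have mf : m %= f.
  have dvd_mf : m %| f.
    rewrite -mP rmorphD rmorph1 rmorphXn /= map_polyX rootE hornerD hornerXn hornerC.
    by rewrite (prim_root_half wp) addNr.
  rewrite -(dvdp_size_eqp dvd_mf) sf.
  rewrite -(size_map_poly (ratr : {rmorphism rat -> algC})) -mE.
  by rewrite (minCpoly_cyclotomic wp) size_cyclotomic totient_pfactor // mul1n.
set g := gcdp f p.
have gz : root (map_poly (in_alg L) g) z.
  by rewrite gcdp_map root_gcd fz.
have /dvdpP[h fE] : g %| f by apply: dvdp_gcdl.
have f0 : f != 0 by rewrite -size_poly_eq0 sf.
have : root (map_poly ratr f : {poly algC}) w by rewrite mP; case/andP: mf.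
(* If [w] is a root of the gcd [g], then [f] divides [g] and so [p]. If it is a root of the cofactor
   [h], then [f] divides [h], which is impossible for degree reasons since the root [z] makes [g]
   nonconstant. *)
rewrite {1}fE rmorphM rootM !mP !(eqp_dvdl _ mf) => /orP[fh|fg]; last first.
  exact: (dvdp_trans fg (dvdp_gcdr _ _)).
have h0 : h != 0 by apply: contraNneq f0 => h0; rewrite fE h0 mul0r.
have g0 : g != 0 by apply: contraNneq f0 => g0; rewrite fE g0 mulr0.
have := dvdp_leq h0 fh; rewrite {1}fE size_mul //.
have : (1 < size g)%N.
  rewrite -(size_map_poly (in_alg L)); apply: root_size_gt1 gz.
  by rewrite map_poly_eq0.
have : (0 < size h)%N by rewrite size_poly_gt0.
case: (size h) (size g) => [|a] // [|[|b]] //= _ _.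
by rewrite !addnS ltnS ltnNge leq_addr.
Qed.

Section RootsOfUnity.
Variables (L : nat -> fieldExtType rat) (zeta : forall m, L m).
Hypothesis zetaP : forall m, (0 < m)%N -> m.-primitive_root (zeta m).

(** The polynomial with coefficients [c j] is divisible by X - 1 and by every X^(2^a) + 1 with
    [a < N]. Successive factors are coprime because they differ by the constant 2, so X^(2^N) - 1
    divides a polynomial of smaller degree. *)
Lemma pow2_root_free N (c : nat -> rat) :
  (forall l, (l <= N)%N ->
     \sum_(0 <= j < 2 ^ N) (c j)%:A * zeta (2 ^ l) ^+ j = 0) ->
  forall j, (j < 2 ^ N)%N -> c j = 0.
Proof.
move=> H; pose p := \poly_(j < 2 ^ N) c j.
have Hr l : (l <= N)%N -> root (map_poly (in_alg (L (2 ^ l)%N)) p) (zeta (2 ^ l)).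
  move=> lN; rewrite rootE (_ : map_poly _ p = \poly_(j < 2 ^ N) (c j)%:A); last first.
    apply/polyP=> i; rewrite coef_map !coef_poly /=.
    by case: ifP => //; rewrite scale0r.
  by apply/eqP; rewrite horner_poly; have := H l lN; rewrite big_mkord.
have Hd a : (a <= N)%N -> 'X^(2 ^ a) - 1 %| p.
  elim: a => [_|a IH aN].
    rewrite expn0 expr1 -polyC1 dvdp_XsubCl.
    have := Hr 0%N isT; have /prim_expr_order := zetaP (isT : 0 < 2 ^ 0)%N.
    rewrite expr1 => ->; rewrite rootE -[X in _.[X]](rmorph1 (in_alg _)) horner_map.
    by rewrite rootE fmorph_eq0.
  have -> : 'X^(2 ^ a.+1) - 1 = ('X^(2 ^ a) - 1) * ('X^(2 ^ a) + 1) :> {poly rat}.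
    by rewrite -subr_sqr expr1n -exprM -expnSr.
  have dvdD1 := dvdp_Xpow2D1 (zetaP (expn_gt0 2 a.+1)) (Hr _ aN).
  rewrite Gauss_dvdp ?IH ?(ltnW aN) ?dvdD1 //.
  rewrite coprimep_sym; apply/Bezout_coprimepP; exists (1, -1) => /=.
  rewrite (_ : _ + _ = 2%:R); last by ring.
  by rewrite -polyC_natr -alg_polyC eqp_scale.
have p0 : p = 0.
  apply/eqP; apply: contraTT (Hd N (leqnn N)) => p0; apply/negP=> /(dvdp_leq p0).
  rewrite -polyC1 size_XnsubC ?expn_gt0 // leqNgt ltnS size_poly //.
move=> j jN; have := congr1 (fun q : {poly rat} => q`_j) p0.
by rewrite coef_poly jN coef0.
Qed.

Lemma dim_adjoin_zeta l : (\dim <<1; zeta (2 ^ l)>>%AS <= totient (2 ^ l))%N.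
Proof.
rewrite dim_Fadjoin dimv1 muln1.
have sP := size_minPoly 1%AS (zeta (2 ^ l)).
rewrite -ltnS -sP; case: l {sP} => [|l].
  have -> : zeta (2 ^ 0) = 1.
    by have /prim_expr_order := zetaP (isT : 0 < 2 ^ 0)%N; rewrite expr1.
  have : minPoly 1%AS (1 : L (2 ^ 0)%N) %| 'X - 1%:P.
    by apply: minPoly_dvdp; rewrite ?polyOverXsubC ?mem1v // root_XsubC.
  by move/dvdp_leq; rewrite size_XsubC -size_poly_eq0 size_XsubC; apply.
rewrite totient_pfactor // mul1n.
have <- := size_XnD1 (L (2 ^ l.+1)%N) (expn_gt0 2 l : (0 < 2 ^ l)%N).
apply: dvdp_leq; first by rewrite -size_poly_eq0 size_XnD1 ?expn_gt0.
apply: minPoly_dvdp; first by rewrite rpredD ?rpred1 // polyOverXn.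
rewrite rootE hornerD hornerXn hornerC.
by rewrite (prim_root_half (zetaP (expn_gt0 2 l.+1))) addNr.
Qed.

End RootsOfUnity.

(** * Normal form in the holomorph *)

Section HolStructure.
Local Open Scope group_scope.

(* The order of G makes the normal form unique. *)
Definition hol_gens n (G : finGroupType) (c s t : G) :=
  [/\ [/\ c ^+ (2 ^ n) = 1, s ^+ (2 ^ (n - 2)) = 1, t ^+ 2 = 1,
          t * s = s * t & c * t = t * c ^+ (2 ^ n - 1) /\ c * s = s * c ^+ 5],
      forall h, exists e j i, [/\ (e < 2)%N, (j < 2 ^ (n - 2))%N, (i < 2 ^ n)%N
                                 & h = t ^+ e * s ^+ j * c ^+ i]
    & #|{: G}| = (2 * 2 ^ (n - 2) * 2 ^ n)%N].

(** Since [3 <= n], the structure theorem for automorphisms of a cyclic 2-group gives [Aut C] as the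
    direct product of the cyclic groups generated by the fifth power map [s0] and the inversion
    [t0]. The relations of [c] with [s] and [t] are the action in the semidirect product. *)
Lemma hol_gens_exist n (gT : finGroupType) (C : {group gT}) :
    (3 <= n)%N -> cyclic C -> #|C| = (2 ^ n)%N ->
  exists c s t : Hol C, hol_gens n c s t.
Proof.
move=> n3 cycC oC.
have pC : 2.-group C by rewrite /pgroup oC pnatX.
have ntC : C :!=: 1 by rewrite -cardG_gt1 oC (ltn_exp2l 0) // (leq_trans _ n3).
have lC : logn 2 #|C| = n by rewrite oC pfactorK.
have [m] := cyclic_pgroup_Aut_structure pC cycC ntC.
rewrite /= lC; have -> : (n.-1 == 0)%N = false by lia.
have -> : (n.-1 == 1)%N = false by lia.
case=> [[def_m _ _ _ _] [abA _ _ _] [t0 [At ot mt [s0 [As os ms defA _]]]]].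
have [x0 defC] := cyclicP cycC.
have Cx : x0 \in C by rewrite defC cycle_id.
have ox : #[x0] = (2 ^ n)%N by rewrite -oC defC.
have t0x : t0 x0 = x0 ^+ (2 ^ n - 1).
  by rewrite -(def_m _ _ At Cx) mt expg_zneg // expg1 invg_expg ox subn1.
have s0x : s0 x0 = x0 ^+ 5 by rewrite -(def_m _ _ As Cx) ms expg_znat.
set to := [Aut C]%gact.
pose c := sdpair1 to x0; pose s := sdpair2 to s0; pose t := sdpair2 to t0.
exists c, s, t.
have cJ a k : a \in Aut C -> a x0 = x0 ^+ k -> c * sdpair2 to a = sdpair2 to a * c ^+ k.
  move=> Aa ax; rewrite -(morphX (sdpair1_morphism to)) // -ax.
  by rewrite conjgC -sdpair_act.
split.
- split; last by split; apply: cJ.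
  + by rewrite -(morphX (sdpair1_morphism to)) // -ox expg_order morph1.
  + by rewrite -(morphX (sdpair2_morphism to)) // subnS subn1 /= -os expg_order morph1.
  + by rewrite -(morphX (sdpair2_morphism to)) // -ot expg_order morph1.
  + rewrite -!(morphM (sdpair2_morphism to)) //; congr sdpair2.
    by apply: (centsP abA).
- move=> h; rewrite [h]sdpairE; case: h => [[a x] /= /setXP[Aa]].
  rewrite {1}defC => /cycleP[i ->]; move: Aa; have [_ <- _ _] := dprodP defA.
  case/mulsgP=> _ _ /cycleP[j ->] /cycleP[e ->] ->.
  exists (e %% 2)%N, (j %% 2 ^ (n - 2))%N, (i %% 2 ^ n)%N.
  rewrite !ltn_mod !expn_gt0; split=> //=.
  rewrite -!(morphX (sdpair2_morphism to)) // -(morphX (sdpair1_morphism to)) //.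
  rewrite -{1}ot -{1}ox subnS subn1 -{1}os !expg_mod_order.
  rewrite -(morphM (sdpair2_morphism to)) ?groupX //.
  by congr (sdpair2 to _ * _); apply: (centsP abA); rewrite groupX.
- rewrite -cardsT -(sdprod_card (sdprod_sdpair to)).
  rewrite !card_injm ?injm_sdpair1 ?injm_sdpair2 //.
  have [_ _ _ tiA] := dprodP defA.
  have := TI_cardMg tiA; have [_ -> _ _] := dprodP defA => ->.
  rewrite -!orderE os ot oC subnS subn1; lia.
Qed.
End HolStructure.

Lemma expg_twist_comm (gT : groupType) (x y : gT) g a j :
  (x * y = y * x ^+ g -> x ^+ a * y ^+ j = y ^+ j * x ^+ (a * g ^ j))%g.
Proof.
move=> xy; have xya b : (x ^+ b * y = y * x ^+ (b * g))%g.
  elim: b => [|b IH]; first by rewrite mul1g mulg1.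
  by rewrite expgS -mulgA IH mulgA xy -mulgA -expgnDr mulSn.
elim: j a => [|j IH] a; first by rewrite mulg1 mul1g muln1.
by rewrite expgSr mulgA IH -!mulgA xya expnSr mulnA.
Qed.

Section HolHom.
Variables (n : nat) (G : finGroupType) (c s t : G).
Hypothesis gensP : hol_gens n c s t.

Definition hol_nf (p : 'I_2 * 'I_(2 ^ (n - 2)) * 'I_(2 ^ n)) : G :=
  (t ^+ p.1.1 * s ^+ p.1.2 * c ^+ p.2)%g.

Lemma hol_nf_bij : bijective hol_nf.
Proof.
have [_ nf oG] := gensP.
have surj h : exists p, hol_nf p = h.
  have [e [j [i [e2 j2 i2 ->]]]] := nf h.
  by exists (Ordinal e2, Ordinal j2, Ordinal i2).
have img : [set hol_nf p | p in setT] = setT.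
  apply/setP=> h; rewrite inE; have [p <-] := surj h.
  by rewrite imset_f.
apply: inj_card_bij; last by rewrite oG !card_prod !card_ord.
have /imset_injP inj :
    #|hol_nf @: setT| == #|[set: 'I_2 * 'I_(2 ^ (n - 2)) * 'I_(2 ^ n)]|.
  by rewrite img !cardsT oG !card_prod !card_ord.
by move=> p q; apply: inj; rewrite inE.
Qed.

Lemma sum_hol (V : nmodType) (f : G -> V) :
  \sum_h f h = \sum_(0 <= e < 2) \sum_(0 <= j < 2 ^ (n - 2))
                 \sum_(0 <= i < 2 ^ n) f (t ^+ e * s ^+ j * c ^+ i)%g.
Proof.
rewrite (reindex hol_nf) /=; last exact: onW_bij hol_nf_bij.
rewrite big_mkord; under [RHS]eq_bigr => e _.
  rewrite big_mkord; under eq_bigr => j _ do rewrite big_mkord.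
  over.
by rewrite /= pair_bigA /= pair_bigA.
Qed.

Lemma hol_nfM e j i e' j' i' :
  ((t ^+ e * s ^+ j * c ^+ i) * (t ^+ e' * s ^+ j' * c ^+ i') =
   t ^+ (e + e') * s ^+ (j + j') *
     c ^+ (i * ((2 ^ n - 1) ^ e' * 5 ^ j') + i'))%g.
Proof.
have [[_ _ _ ts [ct cs]] _ _] := gensP.
have st : (s ^+ j * t ^+ e' = t ^+ e' * s ^+ j)%g by apply: commuteX2.
rewrite !expgnDr mulnA -!mulgA; congr (_ * _)%g.
rewrite (mulgA (c ^+ i)%g) (expg_twist_comm i e' ct) -!mulgA.
rewrite (mulgA (c ^+ _)%g (s ^+ j')%g) (expg_twist_comm _ j' cs) -!mulgA.
by rewrite mulgA st !mulgA.
Qed.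

Section Hom.
Variables (B : pzRingType) (X S T : B).
Hypotheses (X1 : X ^+ (2 ^ n) = 1) (S1 : S ^+ (2 ^ (n - 2)) = 1).
Hypotheses (T1 : T * T = 1) (TS : T * S = S * T).
Hypotheses (XT : X * T = T * X ^+ (2 ^ n - 1)) (XS : X * S = S * X ^+ 5).

(** As [hol_nf] is bijective, the search always succeeds and the default [1] is never returned. *)
Definition hol_hom (h : G) : B :=
  if [pick p | hol_nf p == h] is Some p then
    T ^+ p.1.1 * S ^+ p.1.2 * X ^+ p.2
  else 1.

Lemma hol_homE e j i :
  hol_hom (t ^+ e * s ^+ j * c ^+ i)%g = T ^+ e * S ^+ j * X ^+ i.
Proof.
have [[c1 s1 t1 _ _] _ _] := gensP.
pose p : 'I_2 * 'I_(2 ^ (n - 2)) * 'I_(2 ^ n) :=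
  (Ordinal (ltn_pmod e (isT : 0 < 2)%N), Ordinal (ltn_pmod j (expn_gt0 2 _ : 0 < _)%N),
   Ordinal (ltn_pmod i (expn_gt0 2 _ : 0 < _)%N)).
have pE : hol_nf p = (t ^+ e * s ^+ j * c ^+ i)%g.
  by rewrite /hol_nf /= (expg_mod _ t1) (expg_mod _ s1) (expg_mod _ c1).
rewrite /hol_hom; case: pickP => [q /eqP|/(_ p)]; last by rewrite pE eqxx.
rewrite -pE => /(bij_inj hol_nf_bij) ->.
by rewrite /p /= (expr_mod e (T1 : T ^+ 2 = 1)) (expr_mod j S1) (expr_mod i X1).
Qed.

Lemma hol_hom1 : hol_hom 1%g = 1.
Proof. by have := hol_homE 0 0 0; rewrite !expg0 !mulg1 !expr0 !mulr1. Qed.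

Lemma hol_homM : {morph hol_hom : g h / (g * h)%g >-> g * h}.
Proof.
have [_ nf _] := gensP.
move=> g h; have [e [j [i [_ _ _ ->]]]] := nf g.
have [e' [j' [i' [_ _ _ ->]]]] := nf h.
rewrite hol_nfM !hol_homE.
have ST : S ^+ j * T ^+ e' = T ^+ e' * S ^+ j by apply: commrX; apply/commr_sym/commrX.
rewrite !exprD mulnA -!mulrA; congr (_ * _).
rewrite (mulrA (X ^+ i)) (expr_twist_comm i e' XT) -!mulrA.
rewrite (mulrA (X ^+ _) (S ^+ j')) (expr_twist_comm _ j' XS) -!mulrA.
by rewrite [RHS]mulrA ST !mulrA.
Qed.

End Hom.
End HolHom.

(** * Algebra morphisms out of the group algebra *)

(* The scaling sc is a parameter because mx_alg and dsum carry ring and module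
   structures but no joint algebra structure. *)
Definition alg_hom (R : comNzRingType) (A : lalgType R) (B : pzRingType)
    (sc : R -> B -> B) (f : A -> B) :=
  [/\ forall a u v, f (a *: u + v) = sc a (f u) + f v,
      f 1 = 1 & {morph f : u v / u * v}].

Section LinearExtension.
Variables (R : comNzRingType) (G : finGroupType) (B : pzRingType).
Variables (iota : {rmorphism R -> B}) (Phi : G -> B).
Hypothesis iotaC : forall a b, iota a * b = b * iota a.
Hypotheses (Phi1 : Phi 1%g = 1) (PhiM : {morph Phi : g h / (g * h)%g >-> g * h}).

Definition lin_ext (u : group_alg R G) : B := \sum_h iota (u h) * Phi h.

Lemma lin_ext_hom : alg_hom (fun a b => iota a * b) lin_ext.
Proof.
split.
- move=> a u v; rewrite /lin_ext mulr_sumr -big_split /=; apply: eq_bigr => h _.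
  by rewrite !ffunE rmorphD rmorphM mulrDl mulrA.
- rewrite /lin_ext (bigD1 1%g) //= big1 => [|h h1].
    by rewrite ffunE eqxx rmorph1 mul1r addr0.
  by rewrite ffunE (negPf h1) rmorph0 mul0r.
move=> u v; rewrite /lin_ext mulr_suml.
under eq_bigr => h _ do rewrite ffunE rmorph_sum mulr_suml.
rewrite exchange_big /=; apply: eq_bigr => y _.
rewrite (reindex_inj (mulgI y)) mulr_sumr; apply: eq_bigr => z _.
rewrite mulKg PhiM rmorphM -!mulrA; congr (_ * _).
by rewrite mulrA iotaC -!mulrA iotaC.
Qed.

(** The kernel is stable under right translation: multiply the relation on the right by the image of
    the inverse of [g]. Every linear relation obtained from the kernel thus holds at all [g]. *)
Lemma lin_ext_shift u g : lin_ext u = 0 -> \sum_h iota (u (h * g)%g) * Phi h = 0.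
Proof.
move=> u0; rewrite (reindex_inj (mulIg g^-1%g)) /=.
under eq_bigr => h _ do rewrite mulgKV PhiM mulrA.
by rewrite -mulr_suml -/(lin_ext u) u0 mul0r.
Qed.

End LinearExtension.

Lemma sum_nat_dvd (V : nmodType) (F : nat -> V) q r : (0 < q)%N ->
  (forall j, ~~ (q %| j)%N -> F j = 0) ->
  \sum_(0 <= j < q * r) F j = \sum_(0 <= j < r) F (q * j)%N.
Proof.
move=> q0 F0; elim: r => [|r IH]; first by rewrite muln0 !big_geq.
rewrite big_nat_recr //= -IH mulnSr (big_cat_nat _ (leq_addr q (q * r))) //=.
congr (_ + _); rewrite big_ltn ?(leq_trans _ (leq_add (leqnn _) q0)) ?addn1 //.
rewrite big_nat_cond big1 ?addr0 // => j /andP[/andP[j1 j2] _].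
apply: F0; apply/negP=> /dvdnP[a ja]; move: j1 j2.
by rewrite ja (mulnC a) -mulnSr !ltn_mul2l q0 /=; lia.
Qed.

(** * Traces of the representations *)

Section RepTrace.
Variables (F : fieldType) (n k : nat) (z : F) (X S T : 'M[F]_(2 ^ (k - 1))).
Hypotheses (kn : (2 <= k <= n)%N) (repP : hol_rep n k z X S T).
Hypothesis zn : z ^+ (2 ^ (n - k)) = 1.

Lemma hol_rep_X b : X ^+ (2 ^ (k - 1) * b.*2.+1) = -1.
Proof. by have [Xm _ _ _ _] := repP; rewrite exprM Xm -signr_odd /= odd_double. Qed.

Lemma hol_rep_Xn : X ^+ (2 ^ n) = 1.
Proof.
have /andP[k2 kn'] := kn; have [Xm _ _ _ _] := repP.
have -> : (2 ^ n = 2 ^ (k - 1) * 2 * 2 ^ (n - k))%N.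
  by rewrite -expnSr -expnD; congr (2 ^ _)%N; lia.
by rewrite 2!exprM Xm sqrrN !expr1n.
Qed.

Lemma hol_rep_Sq j : S ^+ (2 ^ (k - 2) * j) = (z ^+ j)%:M.
Proof. by have [_ Sq _ _ _] := repP; rewrite exprM Sq scalar_mxX. Qed.

Lemma hol_rep_Sn : S ^+ (2 ^ (n - 2)) = 1.
Proof.
have /andP[k2 kn'] := kn.
have -> : (2 ^ (n - 2) = 2 ^ (k - 2) * 2 ^ (n - k))%N.
  by rewrite -expnD; congr (2 ^ _)%N; lia.
by rewrite hol_rep_Sq zn.
Qed.

Lemma hol_rep_comm a e j :
  X ^+ a * (T ^+ e * S ^+ j) = T ^+ e * S ^+ j * X ^+ (a * ((2 ^ n - 1) ^ e * 5 ^ j)).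
Proof.
have [_ _ _ _ [XT XS]] := repP.
by rewrite mulrA (expr_twist_comm a e XT) -[LHS]mulrA (expr_twist_comm _ j XS) -!mulrA mulnA.
Qed.

Hypothesis two_neq0 : (2%:R : F) != 0.

(* tr M = tr (Y M Y^-1) = - tr M *)
Lemma mxtrace_anticomm N (M Y Y' : 'M[F]_N) :
  Y * Y' = 1 -> Y * M = - (M * Y) -> \tr M = 0.
Proof.
move=> YY' YM; have : \tr M = - \tr M.
  rewrite -{1}[M]mulr1 -YY' mulrA -[M * Y]opprK -YM mulNr [LHS]raddfN; congr (- _).
  by rewrite [LHS]mxtrace_mulC [Y' *m _]mulmxA [Y' *m Y](mulmx1C YY') mul1mx.
move/eqP; rewrite -addr_eq0 -mulr2n -mulr_natr mulf_eq0 (negPf two_neq0) orbF.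
by move/eqP.
Qed.

(** In the first case the matrix is scalar. In the other cases some invertible monomial in the
    generators anticommutes with it, which kills the trace. *)
Lemma hol_rep_trace e j i : (e < 2)%N ->
  \tr (T ^+ e * S ^+ j * X ^+ i) =
  if [&& e == 0%N, (2 ^ (k - 2) %| j)%N & (2 ^ (k - 1) %| i)%N]
  then z ^+ (j %/ 2 ^ (k - 2)) * (-1) ^+ (i %/ 2 ^ (k - 1)) * (2 ^ (k - 1))%:R
  else 0.
Proof.
move=> e2; case: andP => [[/eqP-> /andP[/dvdnP[j1 ->] /dvdnP[i1 ->]]]|].
  rewrite !mulnK ?expn_gt0 // expr0 mul1r mulnC hol_rep_Sq.
  have [Xm _ _ _ _] := repP; rewrite mulnC exprM Xm.
  rewrite -(raddfN (@scalar_mx F _)) scalar_mxX [X in \tr X]mul_scalar_mx.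
  by rewrite scale_scalar_mx mxtrace_scalar mulr_natr.
have /andP[k2 kn'] := kn.
have [/andP[/eqP e0 qj]|nej] := boolP ((e == 0%N) && (2 ^ (k - 2) %| j)%N).
  rewrite e0 qj /= => im.
  (* Now [S ^+ j] is scalar, and moving [X ^+ i] past [T ^+ e' * S ^+ j'] multiplies it by an odd
     power of [X ^+ (2 ^ (k - 1)) = -1]. *)
  have [|e' [j' [b Hb]]] := @unit_move_half n k i kn; first by apply/negP=> im'; apply: im.
  have [j1 ->] := dvdnP qj; rewrite expr0 mul1r mulnC hol_rep_Sq.
  have [_ _ T1 _ _] := repP.
  apply: (@mxtrace_anticomm _ _ (T ^+ e' * S ^+ j')
           (S ^+ (j' * (2 ^ (n - 2) - 1)) * T ^+ e')).
    rewrite -mulrA (mulrA (S ^+ j')) -exprD -mulnS -[(_ - 1).+1%N]addn1.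
    rewrite subnK ?expn_gt0 //.
    rewrite mulnC exprM hol_rep_Sn expr1n mul1r -exprMn_comm //.
    by rewrite T1 expr1n.
  have zC (Y : 'M[F]_(2 ^ (k - 1))) : (z ^+ j1)%:M * Y = Y * (z ^+ j1)%:M.
    exact: (esym (scalar_mxC _ _)).
  rewrite mulrA -zC -!mulrA -mulrN; congr (_ * _); rewrite (mulrA (X ^+ i)).
  have u0 : (0 < (2 ^ n - 1) ^ e' * 5 ^ j')%N.
    rewrite muln_gt0 !expn_gt0 subn_gt0 /=; case: (n) kn k2 => [|n'] //.
      by lia.
    by rewrite (ltn_exp2l 0).
  rewrite -mulrA hol_rep_comm -[X in (i * X)%N](subnK u0) addn1 mulnS exprD Hb.
  by rewrite hol_rep_X mulrN mulr1 mulrN opprK mulrA.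
move=> _; have u0 : (0 < (2 ^ n - 1) ^ e * 5 ^ j)%N.
  rewrite muln_gt0 !expn_gt0 subn_gt0 /=; case: (n) kn k2 => [|n'] //.
    by lia.
  by rewrite (ltn_exp2l 0).
(* Moving [X ^+ v] past [T ^+ e * S ^+ j] produces an extra odd power of
   [X ^+ (2 ^ (k - 1)) = -1]. *)
have [v [b Hb]] := dvdn_half_multiple (unit_neq1_mod kn e2 nej).
apply: (@mxtrace_anticomm _ _ (X ^+ v) (X ^+ (v * (2 ^ n - 1)))).
  rewrite -exprD -mulnS -[(_ - 1).+1%N]addn1 subnK ?expn_gt0 //.
  by rewrite mulnC exprM hol_rep_Xn expr1n.
rewrite [LHS]mulrA hol_rep_comm -[X in (v * X)%N](subnK u0) addn1 mulnS mulnC.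
rewrite exprD Hb hol_rep_X mulrN mulr1 mulrN mulNr; congr (- _).
by rewrite -!mulrA -!exprD addnC.
Qed.

End RepTrace.

(** * Products of algebra morphisms *)

Lemma eq_alg_hom (R : comNzRingType) (A : lalgType R) (B : pzRingType)
    (sc sc' : R -> B -> B) (f : A -> B) :
  sc =2 sc' -> alg_hom sc f -> alg_hom sc' f.
Proof. by move=> E [fD f1 fM]; split=> // a u v; rewrite fD E. Qed.

(** The predicate [P i] records what vanishing of the component [i] implies, so the kernel of the
    product inherits all these consequences at once. *)
Lemma dsum_alg_hom (R : comNzRingType) (A : lalgType R) (I : choiceType)
    (r : seq I) (B : I -> pzRingType) (sc : forall i, R -> B i -> B i)
    (P : I -> A -> Prop) :
  (forall i, i \in r -> exists f : A -> B i,
     alg_hom (@sc i) f /\ forall u, f u = 0 -> P i u) ->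
  exists f : A -> dsum r (fun i => B i),
    alg_hom (fun a (u : dsum r (fun i => B i)) =>
               [ffun i : seq_sub r => sc (ssval i) a (u i)] : dsum r (fun i => B i)) f
    /\ forall u, f u = 0 -> forall i, i \in r -> P i u.
Proof.
move=> H; have /fin_all_exists[f fP] (i : seq_sub r) : exists f : A -> B (ssval i),
    alg_hom (@sc (ssval i)) f /\ forall u, f u = 0 -> P (ssval i) u.
  exact: H (ssvalP i).
exists (fun u => [ffun i : seq_sub r => f i u]); split; last first.
  move=> u fu0 i ri; have [_] := fP (SeqSub ri); apply.
  have := congr1 (fun v : dsum r (fun i => B i) => v (SeqSub ri)) fu0.
  by rewrite !ffunE.
split.
- by move=> a u v; apply/ffunP=> i; rewrite !ffunE; have [[-> _ _] _] := fP i.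
- by apply/ffunP=> i; rewrite !ffunE; have [[_ -> _] _] := fP i.
- by move=> u v; apply/ffunP=> i; rewrite !ffunE; have [[_ _ ->] _] := fP i.
Qed.

Lemma pair_alg_hom (R : comNzRingType) (A : lalgType R) (B C : pzRingType)
    scB scC (f : A -> B) (g : A -> C) :
  alg_hom scB f -> alg_hom scC g ->
  alg_hom (fun a (p : B * C) => (scB a p.1, scC a p.2)) (fun u => (f u, g u)).
Proof.
case=> [fD f1 fM] [gD g1 gM]; split.
- by move=> a u v; rewrite fD gD.
- by rewrite f1 g1.
- by move=> u v; rewrite fM gM.
Qed.

Lemma sum_nat_lt2 (V : nmodType) (F : nat -> V) :
  \sum_(0 <= e < 2) F e = F 0%N + F 1%N.
Proof. by rewrite big_ltn // big_nat1. Qed.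

(** * Components of the decomposition and the relations on their kernels *)

Section Components.
Variables (n : nat) (G : finGroupType) (c s t : G).
Hypotheses (n2 : (2 <= n)%N) (gensP : hol_gens n c s t).
Variable K : fieldExtType rat.

Lemma natr2_neq0 : (2%:R : K) != 0.
Proof. by rewrite -(rmorph_nat (in_alg K)) fmorph_eq0. Qed.

Lemma signX_2n (b : bool) m : (0 < m)%N -> ((-1) ^+ b : K) ^+ (2 ^ m) = 1.
Proof. by case: m => // m _; rewrite expnS exprM sqrr_sign expr1n. Qed.

Lemma char_component (eps xi : bool) (z : K) : z ^+ (2 ^ (n - 2)) = 1 ->
  exists f : group_alg rat G -> K, alg_hom *:%R f /\ forall u, f u = 0 ->
    forall g, \sum_(0 <= e < 2) \sum_(0 <= j < 2 ^ (n - 2)) \sum_(0 <= i < 2 ^ n)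
      (u (t ^+ e * s ^+ j * c ^+ i * g)%g)%:A
        * (((-1) ^+ eps) ^+ e * z ^+ j * ((-1) ^+ xi) ^+ i) = 0.
Proof.
move=> zn; set X : K := (-1) ^+ xi; set T : K := (-1) ^+ eps.
have Xn : X ^+ (2 ^ n) = 1 by apply: signX_2n; lia.
have X2 : X ^+ 2 = 1 by rewrite sqrr_sign.
have TT : T * T = 1 by rewrite -expr2 sqrr_sign.
have XT : X * T = T * X ^+ (2 ^ n - 1).
  rewrite mulrC; congr (_ * _); rewrite -[LHS]expr1; apply: (expr_mod1 X2).
  by rewrite !modn2 oddB ?expn_gt0 // oddX; case: (n) n2.
have XS : X * z = z * X ^+ 5 by rewrite mulrC (expr_mod1 X2 (erefl : 5 = 1 %[mod 2])%N).
pose Phi := hol_hom n c s t X z T.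
have Phi1 : Phi 1%g = 1 by apply: hol_hom1.
have PhiM : {morph Phi : g h / (g * h)%g >-> g * h}.
  by apply: hol_homM => //; apply: mulrC.
exists (lin_ext (in_alg K) Phi); split.
  apply: eq_alg_hom (lin_ext_hom (iota := in_alg K) _ Phi1 PhiM) => [a b|a b].
    by rewrite mulr_algl.
  exact: mulrC.
move=> u /(lin_ext_shift (iota := in_alg K) PhiM) H g.
apply: etrans (H g); rewrite [RHS](sum_hol gensP).
do 3! (apply: eq_bigr => ? _); congr (_ * _).
by rewrite /Phi hol_homE //; apply: mulrC.
Qed.

(** The two factors are the characters with value 1 and -1 at [t]. Adding their relations cancels
    the terms with [e = 1] and doubles those with [e = 0]. *)
Lemma char_pair_component (xi : bool) (z : K) : z ^+ (2 ^ (n - 2)) = 1 ->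
  exists f : group_alg rat G -> K * K, alg_hom *:%R f /\ forall u, f u = 0 ->
    forall g, \sum_(0 <= j < 2 ^ (n - 2))
      (\sum_(0 <= i < 2 ^ n) ((-1) ^+ xi) ^+ i * u (s ^+ j * c ^+ i * g)%g)%:A
        * z ^+ j = 0.
Proof.
move=> zn; have [f [fH fP]] := char_component false xi zn.
have [f' [fH' fP']] := char_component true xi zn.
exists (fun u => (f u, f' u)); split; first exact: pair_alg_hom.
move=> u [/fP H /fP' H'] g; have := congr2 +%R (H g) (H' g).
rewrite !sum_nat_lt2 add0r.
rewrite addrACA -[X in _ + X]big_split [X in _ + X]big1 /=; last first.
  move=> j _; rewrite -big_split /= big1 // => i _.
  by rewrite !expr1 mul1r !mulN1r mulNr mulrN subrr.
rewrite addr0 -mulr2n -mulr_natr => /eqP; rewrite mulf_eq0 (negPf natr2_neq0) orbF.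
move/eqP=> E; apply: etrans E; apply: eq_bigr => j _; rewrite scaler_suml mulr_suml.
apply: eq_bigr => i _; rewrite expg0 mul1g !mul1r [z ^+ j * _]mulrC mulrA.
congr (_ * _).
by rewrite -[LHS]/(in_alg K _) rmorphM rmorphXn rmorph_sign mulrC.
Qed.

(** The relation is the trace of the matrix identity for the kernel: only the powers of
    [s ^+ (2 ^ (k - 2))] times those of [c ^+ (2 ^ (k - 1))] contribute, and the common factor
    [2 ^ (k - 1)] is cancelled. *)
Lemma mx_component k (z : K) : (2 <= k <= n)%N ->
  (exists2 l, (l <= n - k)%N & (2 ^ l).-primitive_root z) ->
  exists f : group_alg rat G -> mx_alg K (2 ^ (k - 1)),
    alg_hom (B := mx_alg K (2 ^ (k - 1))) (@mx_alg_scale rat K _) f /\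
    forall u, f u = 0 ->
    forall g, \sum_(0 <= j < 2 ^ (n - k))
      (\sum_(0 <= i < 2 ^ (n - k).+1)
          (-1) ^+ i * u (s ^+ (2 ^ (k - 2) * j) * c ^+ (2 ^ (k - 1) * i) * g)%g)%:A
        * z ^+ j = 0.
Proof.
move=> kn [l ln zp]; have [X [S [T repP]]] := hol_rep_exists kn zp.
have zn : z ^+ (2 ^ (n - k)) = 1.
  by rewrite -(subnKC ln) expnD exprM (prim_expr_order zp) expr1n.
have [_ _ T1 TS [XT XS]] := repP.
have Xn := hol_rep_Xn kn repP; have Sn := hol_rep_Sn kn repP zn.
pose Phi := hol_hom n c s t X S T.
have Phi1 : Phi 1%g = 1 := hol_hom1 gensP Xn Sn T1.
have PhiM : {morph Phi : g h / (g * h)%g >-> g * h} := hol_homM gensP Xn Sn T1 TS XT XS.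
pose iota : {rmorphism rat -> 'M[K]_(2 ^ (k - 1))} := scalar_mx \o in_alg K.
have iotaC a b : iota a * b = b * iota a by exact: esym (scalar_mxC _ _).
exists (lin_ext iota Phi); split.
  apply: eq_alg_hom (lin_ext_hom iotaC Phi1 PhiM) => a b.
  rewrite [LHS]mul_scalar_mx; apply/matrixP=> i j; rewrite !mxE.
  by rewrite mulr_algl.
move=> u /(lin_ext_shift PhiM) H g.
have trE e j i : \tr (iota (u (t ^+ e * s ^+ j * c ^+ i * g)%g) *
      Phi (t ^+ e * s ^+ j * c ^+ i)%g) =
    (u (t ^+ e * s ^+ j * c ^+ i * g)%g)%:A * \tr (T ^+ e * S ^+ j * X ^+ i).
  by rewrite [iota _ * _]mul_scalar_mx mxtraceZ /Phi hol_homE.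
have trP := hol_rep_trace kn repP zn natr2_neq0.
have {H} := congr1 mxtrace (H g); rewrite raddf_sum raddf0 (sum_hol gensP) /= sum_nat_lt2.
rewrite [X in _ + X]big1 ?addr0 => [|j _]; last first.
  by rewrite big1 // => i _; rewrite trE trP //= mulr0.
have /andP[k2 kn'] := kn.
have -> : (2 ^ (n - 2) = 2 ^ (k - 2) * 2 ^ (n - k))%N.
  by rewrite -expnD; congr (2 ^ _)%N; lia.
rewrite sum_nat_dvd ?expn_gt0 // => [|j qj]; last first.
  by rewrite big1 // => i _; rewrite trE trP //= (negPf qj) mulr0.
have -> : (2 ^ n = 2 ^ (k - 1) * 2 ^ (n - k).+1)%N.
  by rewrite -expnD; congr (2 ^ _)%N; lia.
move=> H; have m0 : ((2 ^ (k - 1))%:R : K) != 0.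
  by rewrite natrX expf_neq0 // natr2_neq0.
apply: (mulIf m0); rewrite mul0r; apply: etrans H.
rewrite mulr_suml; apply: eq_bigr => j _.
rewrite sum_nat_dvd ?expn_gt0 // => [|i mi]; last first.
  by rewrite trE trP //= (negPf mi) andbF mulr0.
rewrite scaler_suml !mulr_suml; apply: eq_bigr => i _.
rewrite trE trP //= !dvdn_mulr //= ![(2 ^ _ * _)%N]mulnC !mulnK ?expn_gt0 //.
rewrite expg0 mul1g -[in LHS]/(in_alg K _) rmorphM rmorphXn rmorphN1.
rewrite /= mulrA; congr (_ * _).
by rewrite -mulrA mulrC -mulrA.
Qed.

End Components.

(** * Dimension count *)

(* A coordinate-free way to say that V has dimension at most d. *)
Definition sep_forms (R : fieldType) (V : lmodType R) (d : nat) :=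
  exists g : 'I_d -> V -> R,
    (forall i a u v, g i (a *: u + v) = a * g i u + g i v)
    /\ forall v, (forall i, g i v = 0) -> v = 0.

Section SepForms.
Variable R : fieldType.

Lemma sep_forms_fin (V : lmodType R) (I : finType) (g : I -> V -> R) :
  (forall i a u v, g i (a *: u + v) = a * g i u + g i v) ->
  (forall v, (forall i, g i v = 0) -> v = 0) -> sep_forms V #|I|.
Proof.
move=> gD g0; exists (fun i => g (enum_val i)); split=> [i|v H]; first exact: gD.
by apply: g0 => i; rewrite -(enum_rankK i) H.
Qed.

Lemma sep_formsW (V : lmodType R) d d' :
  (d <= d')%N -> sep_forms V d -> sep_forms V d'.
Proof.
move=> dd' [g [gD g0]].
exists (fun i v => if insub (val i) is Some j then g j v else 0); split.
  by move=> i a u v; case: insubP => [j _ _|_]; rewrite ?gD // mulr0 addr0.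
move=> v H; apply: g0 => i; have := H (widen_ord dd' i).
by rewrite (_ : insub _ = Some i) //; apply: valK i.
Qed.

Lemma sep_forms_pair (V W : lmodType R) d e :
  sep_forms V d -> sep_forms W e -> sep_forms (V * W)%type (d + e).
Proof.
move=> [g [gD g0]] [h [hD h0]].
have -> : (d + e = #|{: 'I_d + 'I_e}|)%N by rewrite card_sum !card_ord.
apply: (@sep_forms_fin _ _
  (fun i p => match i with inl j => g j p.1 | inr j => h j p.2 end)).
  by case=> j a u v /=; rewrite ?gD ?hD.
case=> v w H; congr (_, _); first by apply: g0 => i; apply: (H (inl i)).
by apply: h0 => i; apply: (H (inr i)).
Qed.

Lemma sum_seq_sub (I : choiceType) (r : seq I) (d : I -> nat) : uniq r ->
  (\sum_(i : seq_sub r) d (ssval i) = \sum_(i <- r) d i)%N.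
Proof.
move=> ur; rewrite -big_enum -(big_map val predT d) /=; apply: perm_big.
apply: uniq_perm => //; first by rewrite map_inj_uniq ?enum_uniq //; apply: val_inj.
move=> i; apply/mapP/idP=> [[j _ ->]|ri]; first exact: valP.
by exists (SeqSub ri); rewrite ?mem_enum.
Qed.

Lemma sep_forms_dsum (I : choiceType) (r : seq I) (V : I -> lmodType R) (d : I -> nat) :
  uniq r -> (forall i, i \in r -> sep_forms (V i) (d i)) ->
  sep_forms (dsum r (fun i => V i)) (\sum_(i <- r) d i).
Proof.
move=> ur H; rewrite -sum_seq_sub //.
have /fin_all_exists[g gP] (i : seq_sub r) :
    exists g : 'I_(d (ssval i)) -> V (ssval i) -> R,
    (forall j a u v, g j (a *: u + v) = a * g j u + g j v)
    /\ forall v, (forall j, g j v = 0) -> v = 0.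
  exact: H (ssvalP i).
have -> : (\sum_(i : seq_sub r) d (ssval i)
    = #|{: {i : seq_sub r & 'I_(d (ssval i))}}|)%N.
  rewrite card_tagged sumnE big_map big_enum.
  by apply: eq_bigr => i _; rewrite card_ord.
apply: (@sep_forms_fin _ _
  (fun p (v : dsum r (fun i => V i)) => g (tag p) (tagged p) (v (tag p)))).
  by case=> i j a u v /=; have [gD _] := gP i; rewrite -gD !ffunE.
move=> v v0; apply/ffunP=> i; rewrite [RHS]ffunE; have [_ g0] := gP i.
by apply: g0 => j; apply: (v0 (Tagged _ j)).
Qed.

Lemma sep_forms_mx (K : lalgType R) m d :
  sep_forms K d -> sep_forms (mx_alg K m) (m * m * d).
Proof.
move=> [g [gD g0]].
have -> : (m * m * d = #|{: 'I_m * 'I_m * 'I_d}|)%N by rewrite !card_prod !card_ord.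
apply: (@sep_forms_fin _ _ (fun p (v : mx_alg K m) => g p.2 (v p.1.1 p.1.2))).
  by case=> [[i j] l] a u v /=; rewrite -gD !mxE.
move=> v H; apply/matrixP=> i j; rewrite mxE; apply: g0 => l.
exact: (H (i, j, l)).
Qed.

Lemma sep_forms_subvs (V : vectType R) (U : {vspace V}) :
  sep_forms (subvs_of U) (\dim U).
Proof.
exists (fun i (v : subvs_of U) => coord (vbasis U) i (vsval v)); split.
  by move=> i a u v; rewrite linearP.
move=> v H; apply: val_inj; rewrite /= (coord_vbasis (subvsP v)) big1 // => i _.
by rewrite H scale0r.
Qed.

(** Composing [f] with the forms gives an injective linear map between spaces of the same dimension
    [#|G|], hence an invertible matrix [M]. Inverting it on the values of the forms at [y] yields a
    preimage of [y], because the forms separate points. *)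
Lemma sep_forms_bij (G : finGroupType) (V : lmodType R) (f : group_alg R G -> V) :
  (forall a u v, f (a *: u + v) = a *: f u + f v) ->
  (forall u, f u = 0 -> u = 0) -> sep_forms V #|G| -> bijective f.
Proof.
move=> fD f0 [g [gD g0]].
pose e (v : 'rV[R]_#|G|) : group_alg R G := [ffun h => v 0 (enum_rank h)].
have eD a v w : e (a *: v + w) = a *: e v + e w.
  by apply/ffunP=> h; rewrite !ffunE !mxE.
have e0 v : e v = 0 -> v = 0.
  move=> ev; apply/rowP=> i.
  have := congr1 (fun u : group_alg R G => u (enum_val i)) ev.
  by rewrite !ffunE enum_valK mxE.
have gB i u v : g i (u - v) = g i u - g i v.
  by rewrite [u - v]addrC -scaleN1r gD mulN1r addrC.
have fB u v : f (u - v) = f u - f v.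
  by rewrite [u - v]addrC -[- v]scaleN1r fD scaleN1r addrC.
pose phi (v : 'rV[R]_#|G|) : 'rV[R]_#|G| := \row_i g i (f (e v)).
have phiD : linear phi.
  by move=> a v w; apply/rowP=> i; rewrite !mxE eD fD gD.
pose phiL := HB.pack_for {linear 'rV[R]_#|G| -> 'rV[R]_#|G|} phi
  (GRing.isLinear.Build _ _ _ _ phi phiD).
pose M := lin1_mx phiL.
have ME v : v *m M = phi v by rewrite mul_rV_lin1.
have Mu : M \in unitmx.
  rewrite -row_free_unit; apply: inj_row_free => v; rewrite ME => pv.
  apply/e0/f0/g0 => i; have := congr1 (fun w : 'rV_#|G| => w 0 i) pv.
  by rewrite !mxE.
pose h y := e (\row_i g i y *m invmx M).
have fh y : f (h y) = y.
  apply/eqP; rewrite -subr_eq0; apply/eqP/g0 => i; rewrite gB.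
  have := congr1 (fun w : 'rV_#|G| => w 0 i) (ME (\row_i g i y *m invmx M)).
  by rewrite mulmxKV // !mxE => ->; rewrite subrr.
exists h => // u; apply/eqP; rewrite -subr_eq0; apply/eqP/f0.
by rewrite fB fh subrr.
Qed.

End SepForms.

Lemma alg_hom_lrmorphism (R : comNzRingType) (A : lalgType R) (B : pzRingType)
    (sc : R -> B -> B) (f : A -> B) : sc 1 =1 id -> alg_hom sc f ->
  exists g : {lrmorphism A -> B | sc}, g =1 f.
Proof.
move=> sc1 [fD f1 fM].
have fA u v : f (u + v) = f u + f v by rewrite -[u]scale1r fD sc1 scale1r.
have f0 : f 0 = 0 by apply: (addrI (f 0)); rewrite -fA !addr0.
have fB u v : f (u - v) = f u - f v.
  by apply: (addIr (f v)); rewrite -fA !subrK.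
have fZ a u : f (a *: u) = sc a (f u) by rewrite -[a *: u]addr0 fD f0 addr0.
pose g := HB.pack_for {lrmorphism A -> B | sc} f
  (GRing.isZmodMorphism.Build A B f fB)
  (GRing.isMonoidMorphism.Build A B f (conj f1 fM))
  (GRing.isScalable.Build R A B sc f fZ).
by exists g.
Qed.

Lemma sum_totient_pow2 N : (\sum_(0 <= l < N.+1) totient (2 ^ l) = 2 ^ N)%N.
Proof.
elim: N => [|N IH]; first by rewrite big_nat1.
by rewrite big_nat_recr //= IH totient_pfactor // mul1n expnS mul2n addnn.
Qed.

Lemma sum_totient_divisors_pow2 N :
  (\sum_(d <- divisors (2 ^ N)) totient d = 2 ^ N)%N.
Proof.
rewrite -[RHS]sum_totient_pow2 -(big_map (expn 2) predT totient); apply: perm_big.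
apply: uniq_perm; rewrite ?divisors_uniq //.
  by rewrite map_inj_uniq ?iota_uniq //; apply: expnI.
move=> d; rewrite -dvdn_divisors ?expn_gt0 //.
apply/(dvdn_pfactor _ _ (isT : prime 2))/mapP => [[l lN ->]|[l]].
  by exists l; rewrite // mem_index_iota.
by rewrite mem_index_iota => lN ->; exists l.
Qed.

Lemma decomposition_dim n : (2 <= n)%N ->
  (2 ^ (n - 1) + 2 ^ (n - 1) + \sum_(k <- index_iota 2 n.+1) 2 ^ (n + k - 2)
   = 2 * 2 ^ (n - 2) * 2 ^ n)%N.
Proof.
(* Adding [2 ^ n] to the geometric sum lets it double at each step; [m = n - 1] gives the order
   [2 ^ (2 * n - 1)] of the group. *)
move=> n2; have S m : (\sum_(2 <= k < m.+2) 2 ^ (n + k - 2) + 2 ^ n = 2 ^ (n + m))%N.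
  elim: m => [|m IH]; first by rewrite big_geq // addn0.
  rewrite big_nat_recr //= addnAC IH (_ : n + m.+2 - 2 = n + m)%N; last by lia.
  by rewrite addnS expnS addnn mul2n.
have := S n.-1; rewrite prednK; last by lia.
rewrite addnn -mul2n -!expnS -expnD (_ : (n - 1).+1 = n)%N; last by lia.
by rewrite addnC => ->; congr (2 ^ _)%N; lia.
Qed.

(* Adding the relations for (-1)^i to the sums over cosets of <c^(2^a)> gives those
   over cosets of <c^(2^(a+1))>. *)
Lemma group_alg_eq0 n (G : finGroupType) (c : G) (u : group_alg rat G) :
  (forall (xi : bool) g,
     \sum_(0 <= i < 2 ^ n) ((-1) ^+ xi) ^+ i * u (c ^+ i * g)%g = 0) ->
  (forall k g, (2 <= k <= n)%N ->
     \sum_(0 <= i < 2 ^ (n - k).+1) (-1) ^+ i * u (c ^+ (2 ^ (k - 1) * i) * g)%g = 0) ->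
  u = 0.
Proof.
move=> H1 H2; suff H a : (a <= n)%N -> forall g,
    \sum_(0 <= i < 2 ^ (n - a)) u (c ^+ (2 ^ a * i) * g)%g = 0.
  apply/ffunP=> g; have := H n (leqnn n) g.
  by rewrite subnn big_nat1 muln0 expg0 mul1g ffunE.
elim: a => [_ g|a IH an g].
  rewrite subn0 -[RHS](H1 false g); apply: eq_bigr => i _.
  by rewrite expr1n !mul1r mul1n.
(* For [a = 0] this is the relation of the characters with value -1 at [c]; for [a > 0] it is the
   relation with [k = a + 1]. *)
have Ha : \sum_(0 <= i < 2 ^ (n - a)) (-1) ^+ i * u (c ^+ (2 ^ a * i) * g)%g = 0.
  case: a {IH} an => [|a] an.
    rewrite subn0 -[RHS](H1 true g); apply: eq_bigr => i _.
    by rewrite mul1n expr1.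
  have := H2 a.+2 g an; rewrite subn1 /= => H; apply: etrans H.
  by congr (\sum_(0 <= i < 2 ^ _) _); lia.
have := congr2 +%R (IH (ltnW an) g) Ha; rewrite addr0 -big_split /=.
have -> : (2 ^ (n - a) = 2 * 2 ^ (n - a.+1))%N by rewrite -expnS; congr (2 ^ _)%N; lia.
rewrite sum_nat_dvd // => [H|j]; last first.
  by rewrite dvdn2 negbK -signr_odd => ->; rewrite expr1 mulN1r subrr.
have two0 : (2%:R : rat) != 0 by [].
apply: (mulfI two0); rewrite mulr0; apply: etrans H; rewrite mulr_sumr.
apply: eq_bigr => i _.
by rewrite mulnA -expnSr exprM sqrrN !expr1n mul1r mulr_natl mulr2n.
Qed.

(** * Assembly of the decomposition *)

Section Decomposition.
Variables (L : nat -> fieldExtType rat) (zeta : forall m, L m).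
Hypothesis zetaP : forall m, (0 < m)%N -> m.-primitive_root (zeta m).

Definition adjoin_gen d : adjoin (zeta d) := Subvs (memv_adjoin 1 (zeta d)).

Lemma adjoin_gen_prim d : (0 < d)%N -> d.-primitive_root (adjoin_gen d).
Proof.
move=> d0; rewrite -(fmorph_primitive_root (@vsval _ _ _ : {rmorphism _ -> _})).
exact: zetaP.
Qed.

Lemma sum_adjoin_gen d N (a : nat -> rat) :
  \sum_(0 <= j < N) (a j)%:A * adjoin_gen d ^+ j = 0 ->
  \sum_(0 <= j < N) (a j)%:A * zeta d ^+ j = 0.
Proof.
have [iota iotaE] : exists iota : {lrmorphism adjoin (zeta d) -> L d}, iota =1 vsval.
  by exists (@vsval _ _ _).
move/(congr1 iota); rewrite raddf_sum raddf0 => H; apply: etrans H.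
by apply: eq_bigr => j _; rewrite /= rmorphM /= linearZ rmorph1 rmorphXn /= iotaE.
Qed.

Variables (n : nat) (G : finGroupType) (c s t : G).
Hypotheses (n2 : (2 <= n)%N) (gensP : hol_gens n c s t).

Local Notation char_sum :=
  (\dsum_(d <- divisors (2 ^ (n - 2))) (adjoin (zeta d) * adjoin (zeta d))).
Local Notation mx_sum k :=
  (\dsum_(l <- index_iota 0 (n - k).+1) mx_alg (adjoin (zeta (2 ^ l)%N)) (2 ^ (k - 1))).

(** The sign [xi] at [c] distinguishes the two copies of the cyclotomic sum; within a copy, the sign
    at [t] gives the pairs and the value at [s] gives [d]. *)
Lemma char_part (xi : bool) :
  exists f : group_alg rat G -> char_sum,
    alg_hom (B := char_sum) *:%R f /\ forall u, f u = 0 ->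
    forall g, \sum_(0 <= i < 2 ^ n) ((-1) ^+ xi) ^+ i * u (c ^+ i * g)%g = 0.
Proof.
have /dsum_alg_hom[f [fH fP]] : forall d, d \in divisors (2 ^ (n - 2)) ->
    exists f : group_alg rat G -> (adjoin (zeta d) * adjoin (zeta d))%type,
    alg_hom (B := (adjoin (zeta d) * adjoin (zeta d))%type) *:%R f /\
    forall u, f u = 0 -> forall g,
    \sum_(0 <= j < 2 ^ (n - 2))
      (\sum_(0 <= i < 2 ^ n) ((-1) ^+ xi) ^+ i * u (s ^+ j * c ^+ i * g)%g)%:A
        * zeta d ^+ j = 0.
  move=> d; rewrite -dvdn_divisors ?expn_gt0 // => dn.
  have d0 : (0 < d)%N by apply: dvdn_gt0 dn; rewrite expn_gt0.
  have zn : adjoin_gen d ^+ (2 ^ (n - 2)) = 1.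
    by apply/eqP; rewrite -(prim_order_dvd (adjoin_gen_prim d0)).
  have [f [fH fP]] := char_pair_component n2 gensP xi zn.
  by exists f; split=> // u /fP H g; apply: sum_adjoin_gen.
exists f; split; first exact: fH.
move=> u /fP H g.
(* Having all orders [2 ^ l] with [l <= n - 2] isolates the coefficient of each power of [s]; the
   one at [j = 0] is the claim. *)
have /(pow2_root_free zetaP) : forall l, (l <= n - 2)%N ->
    \sum_(0 <= j < 2 ^ (n - 2))
      (\sum_(0 <= i < 2 ^ n) ((-1) ^+ xi) ^+ i * u (s ^+ j * c ^+ i * g)%g)%:A
        * zeta (2 ^ l) ^+ j = 0.
  by move=> l ln; apply: H; rewrite -dvdn_divisors ?expn_gt0 // dvdn_exp2l.
move/(_ 0%N (expn_gt0 _ _)) => E; apply: etrans E.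
by apply: eq_bigr => i _; rewrite expg0 mul1g.
Qed.

Lemma mx_part :
  exists f : group_alg rat G -> \dsum_(k <- index_iota 2 n.+1) mx_sum k,
    alg_hom (B := \dsum_(k <- index_iota 2 n.+1) mx_sum k) *:%R f /\
    forall u, f u = 0 ->
    forall k g, (2 <= k <= n)%N ->
      \sum_(0 <= i < 2 ^ (n - k).+1) (-1) ^+ i * u (c ^+ (2 ^ (k - 1) * i) * g)%g = 0.
Proof.
have /dsum_alg_hom[f [fH fP]] : forall k, k \in index_iota 2 n.+1 ->
    exists f : group_alg rat G -> mx_sum k,
    alg_hom (B := mx_sum k) *:%R f /\ forall u, f u = 0 -> forall g,
      \sum_(0 <= i < 2 ^ (n - k).+1) (-1) ^+ i * u (c ^+ (2 ^ (k - 1) * i) * g)%g = 0.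
  move=> k; rewrite mem_index_iota ltnS => kn.
  have /dsum_alg_hom[f [fH fP]] : forall l, l \in index_iota 0 (n - k).+1 ->
      exists f : group_alg rat G -> mx_alg (adjoin (zeta (2 ^ l)%N)) (2 ^ (k - 1)),
      alg_hom (B := mx_alg (adjoin (zeta (2 ^ l)%N)) (2 ^ (k - 1)))
        (@mx_alg_scale rat _ _) f /\ forall u, f u = 0 -> forall g,
      \sum_(0 <= j < 2 ^ (n - k))
        (\sum_(0 <= i < 2 ^ (n - k).+1)
          (-1) ^+ i * u (s ^+ (2 ^ (k - 2) * j) * c ^+ (2 ^ (k - 1) * i) * g)%g)%:A
        * zeta (2 ^ l) ^+ j = 0.
    move=> l; rewrite mem_index_iota ltnS => ln.
    have [|f [fH fP]] := @mx_component n G c s t n2 gensP _ k (adjoin_gen (2 ^ l)) kn.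
      by exists l => //; apply/adjoin_gen_prim/expn_gt0.
    by exists f; split=> // u /fP H g; apply: sum_adjoin_gen.
  exists f; split; first exact: fH.
  move=> u /fP H g.
  have /(pow2_root_free zetaP) : forall l, (l <= n - k)%N ->
      \sum_(0 <= j < 2 ^ (n - k))
        (\sum_(0 <= i < 2 ^ (n - k).+1)
          (-1) ^+ i * u (s ^+ (2 ^ (k - 2) * j) * c ^+ (2 ^ (k - 1) * i) * g)%g)%:A
        * zeta (2 ^ l) ^+ j = 0.
    by move=> l ln; apply: H; rewrite mem_index_iota.
  move/(_ 0%N (expn_gt0 _ _)) => E; apply: etrans E.
  by apply: eq_bigr => i _; rewrite muln0 expg0 mul1g.
exists f; split; first exact: fH.
by move=> u /fP H k g kn; apply: H; rewrite mem_index_iota.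
Qed.

Lemma sep_forms_adjoin l : sep_forms (adjoin (zeta (2 ^ l)%N)) (totient (2 ^ l)).
Proof. exact: sep_formsW (dim_adjoin_zeta zetaP l) (sep_forms_subvs _). Qed.

Lemma sep_forms_char_part : sep_forms char_sum (2 ^ (n - 1)).
Proof.
have -> : (2 ^ (n - 1) = \sum_(d <- divisors (2 ^ (n - 2))) (totient d + totient d))%N.
  rewrite big_split /= sum_totient_divisors_pow2 addnn -mul2n -expnS.
  by congr (2 ^ _)%N; lia.
apply: sep_forms_dsum; first exact: divisors_uniq.
move=> d; rewrite -dvdn_divisors ?expn_gt0 //.
case/(dvdn_pfactor _ _ (isT : prime 2)) => l _ ->.
by apply: sep_forms_pair; apply: sep_forms_adjoin.
Qed.

(** For fixed [k] the matrix size contributes [2 ^ (2 * k - 2)], and the totients of the [2 ^ l]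
    with [l <= n - k] add up to [2 ^ (n - k)]. *)
Lemma sep_forms_mx_part : sep_forms (\dsum_(k <- index_iota 2 n.+1) mx_sum k)
  (\sum_(k <- index_iota 2 n.+1) 2 ^ (n + k - 2)).
Proof.
apply: sep_forms_dsum; first exact: iota_uniq.
move=> k; rewrite mem_index_iota ltnS => kn.
have -> : (2 ^ (n + k - 2) = \sum_(l <- index_iota 0 (n - k).+1)
    (2 ^ (k - 1) * 2 ^ (k - 1) * totient (2 ^ l)))%N.
  by rewrite -big_distrr /= sum_totient_pow2 -!expnD; congr (2 ^ _)%N; lia.
apply: sep_forms_dsum; first exact: iota_uniq.
by move=> l _; apply: sep_forms_mx; apply: sep_forms_adjoin.
Qed.

Lemma hol_gens_decomposition :
  exists f : {lrmorphism group_alg rat G ->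
      char_sum * char_sum * (\dsum_(k <- index_iota 2 n.+1) mx_sum k)},
    bijective f.
Proof.
have [f1 [f1H f1P]] := char_part false; have [f2 [f2H f2P]] := char_part true.
have [f3 [f3H f3P]] := mx_part.
have [f fE] : exists f : {lrmorphism group_alg rat G ->
      char_sum * char_sum * (\dsum_(k <- index_iota 2 n.+1) mx_sum k)},
    f =1 (fun u => (f1 u, f2 u, f3 u)).
  apply: alg_hom_lrmorphism; first exact: scale1r.
  exact: pair_alg_hom (pair_alg_hom f1H f2H) f3H.
exists f; apply: sep_forms_bij; first exact: linearP.
  move=> u; rewrite fE => -[/f1P H1 /f2P H2 /f3P H3].
  by apply: (@group_alg_eq0 n _ c) => // -[] g; [apply: H2 | apply: H1].
have [_ _ ->] := gensP; rewrite -decomposition_dim //.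
apply: sep_forms_pair sep_forms_mx_part.
by apply: sep_forms_pair; apply: sep_forms_char_part.
Qed.

End Decomposition.

Theorem theorem9p3p1 (n : nat) (hn : (3 <= n)%N)
    (gT : finGroupType) (C : {group gT}) (hC : cyclic C)
    (hCn : #|C| = (2 ^ n)%N)
    (L : nat -> fieldExtType rat) (zeta : forall m : nat, L m)
    (hzeta : forall m : nat, (0 < m)%N -> m.-primitive_root (zeta m)) :
  exists f : {lrmorphism group_alg rat (Hol C) ->
      (\dsum_(d <- divisors (2 ^ (n - 2))%N)
         (adjoin (zeta d) * adjoin (zeta d)))
    * (\dsum_(d <- divisors (2 ^ (n - 2))%N)
         (adjoin (zeta d) * adjoin (zeta d)))
    * (\dsum_(k <- index_iota 2 n.+1) \dsum_(l <- index_iota 0 (n - k)%N.+1)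
         mx_alg (adjoin (zeta (2 ^ l)%N)) (2 ^ (k - 1))%N)},
    bijective f.
Proof.
have [c [s [t gensP]]] := hol_gens_exist hn hC hCn.
exact: (hol_gens_decomposition hzeta (ltnW hn) gensP).
Qed.
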